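(* Let $k$ be an infinite field of characteristic $p \geq 0$, let $W$ be a finite-dimensional $k$-vector space, and let $G \subset GL(W)$ be a finite group. Let $T(W)^G$ be the subring of $G$-invariants of the tensor algebra $T(W)$, regarded as a twisted commutative algebra. Then: (1) if $p \nmid \#G$ or $p = 0$, the twisted commutative algebra $T(W)^G$ is noetherian and is generated, as a twisted commutative algebra, by elements of degree $\leq \#G$; (2) if $p > 0$ and $p \mid \#G$, the twisted commutative algebra $T(W)^G$ is not finitely generated.
   Context: Write $\mathfrak{S}_n$ for the symmetric group. An $\mathfrak{S}_*$-representation is a sequence $\{V_n\}_{n \in \mathbf{N}}$ where each $V_n$ is a $k$-linear representation of $\mathfrak{S}_n$; these form a symmetric monoidal abelian category $\mathrm{Rep}(\mathfrak{S}_* )$ with tensor product $(V \boxtimes V')_n = \bigoplus_{i=0}^n \mathrm{Ind}_{\mathfrak{S}_i \times \mathfrak{S}_{n-i}}^{\mathfrak{S}_n} (V_i \otimes V'_{n-i})$ and braiding induced from that of vector spaces. A twisted commutative algebra (tca) is a commutative algebra object in $\mathrm{Rep}(\mathfrak{S}_* )$. Concretely, it is an associative unital $\mathbf{N}$-graded $k$-algebra $A = \bigoplus_{n \ge 0} A_n$ with an action of $\mathfrak{S}_n$ on $A_n$ such that (i) the multiplication $A_n \otimes A_m \to A_{n+m}$ is $(\mathfrak{S}_n \times \mathfrak{S}_m)$-equivariant (standard embedding $\mathfrak{S}_n \times \mathfrak{S}_m \subset \mathfrak{S}_{n+m}$), and (ii) for $x \in A_n$, $y \in A_m$ one has $xy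 = \tau_{m,n}(yx)$, where $\tau_{m,n} \in \mathfrak{S}_{n+m}$ sends $i \mapsto i+n$ for $1 \le i \le m$ and $i \mapsto i-m$ for $m+1 \le i \le n+m$. The tensor algebra $T(W)$ is a tca with $\mathfrak{S}_n$ acting on $T(W)_n = W^{\otimes n}$ by $\sigma(w_1 \cdots w_n) = w_{\sigma^{-1}(1)} \cdots w_{\sigma^{-1}(n)}$. The action of $G$ on $W$ extends to an action on $T(W)$ by tca automorphisms (diagonal on each $W^{\otimes n}$), and $T(W)^G$ is a sub-tca. A tca $R$ is generated by a set of homogeneous elements if the smallest subspace of $R$ containing them (and the unit) and stable under multiplication and the actions of the symmetric groups is $R$ itself. It is finitely generated if it is generated by finitely many homogeneous elements. A module over $R$ is a module object for $R$ in $\mathrm{Rep}(\mathfrak{S}_* )$; $R$ is noetherian if the category of $R$-modules is locally noetherian (equivalently, every submodule of a finitely generated $R$-module is finitely generated). *)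

(* Defs.v *)
From HB Require Import structures.
From mathcomp Require Import all_boot all_order all_fingroup all_algebra.
From mathcomp Require Import finmap.
From mathcomp Require Import classical_sets cardinality.

Set Implicit Arguments.
Unset Strict Implicit.
Unset Printing Implicit Defensive.

Import GRing.Theory.
Local Open Scope ring_scope.

Section BlockPermutations.
Variables m n : nat.

Section Sum.
Variables (s : 'S_m) (t : 'S_n).

Definition osum_fun (i : 'I_(m + n)) : 'I_(m + n) :=
  match split i with
  | inl a => lshift n (s a)
  | inr b => rshift m (t b)
  end.

Lemma osum_fun_inj : injective osum_fun.
Proof.
move=> i j; rewrite /osum_fun.
case: split_ordP => a ->; case: split_ordP => b -> /eqP;
  by rewrite eq_shift // => /eqP /perm_inj ->.
Qed.

(* The image of (s, t) under the standard embedding S_m x S_n -> S_(m+n). *)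
Definition osum : 'S_(m + n) := perm osum_fun_inj.

Lemma osum_lshift a : osum (lshift n a) = lshift n (s a).
Proof. by rewrite permE /osum_fun (unsplitK (inl a)). Qed.

Lemma osum_rshift b : osum (rshift m b) = rshift m (t b).
Proof. by rewrite permE /osum_fun (unsplitK (inr b)). Qed.

End Sum.

Definition tau_fun (i : 'I_(m + n)) : 'I_(m + n) :=
  cast_ord (addnC n m)
    (match split i with inl a => rshift n a | inr b => lshift m b end).

Lemma tau_fun_inj : injective tau_fun.
Proof.
move=> i j /cast_ord_inj.
case: split_ordP => a ->; case: split_ordP => b -> /eqP;
  by rewrite eq_shift // => /eqP ->.
Qed.

(* The block transposition tau_(m,n); see [tauE] for its values. *)
Definition tau : 'S_(m + n) := perm tau_fun_inj.

Lemma tauE (i : 'I_(m + n)) : tau i = (if i < m then i + n else i - m)%N :> nat.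
Proof.
rewrite permE /tau_fun /=; case: split_ordP => a -> /=.
  by rewrite addnC.
by rewrite addKn.
Qed.

Lemma tau_lshift a : tau (lshift n a) = cast_ord (addnC n m) (rshift n a).
Proof. by rewrite permE /tau_fun (unsplitK (inl a)). Qed.

Lemma tau_rshift b : tau (rshift m b) = cast_ord (addnC n m) (lshift m b).
Proof. by rewrite permE /tau_fun (unsplitK (inr b)). Qed.

End BlockPermutations.

Definition gcast (k : fieldType) (V : nat -> lmodType k) (m n : nat) (e : m = n)
    (x : V m) : V n :=
  eq_rect m (fun i => V i : Type) x n e.

(* Since (s * t)%g is "first s, then t" in MathComp, [srep_actM] says that
   [srep_act] is a left action for the usual composition of permutations. *)
Record srep (k : fieldType) := SRep {
  srep_obj :> nat -> lmodType k;
  srep_act : forall n, 'S_n -> srep_obj n -> srep_obj n;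
  srep_act_linear : forall n (s : 'S_n), linear (@srep_act n s);
  srep_act1 : forall n (x : srep_obj n), srep_act 1%g x = x;
  srep_actM : forall n (s t : 'S_n) (x : srep_obj n),
    srep_act (s * t)%g x = srep_act t (srep_act s x) }.

Record tca (k : fieldType) := Tca {
  tca_rep :> srep k;
  tca_one : tca_rep 0%N;
  tca_mul : forall m n, tca_rep m -> tca_rep n -> tca_rep (m + n)%N;
  tca_mul_linearr : forall m n (x : tca_rep m), linear (@tca_mul m n x);
  tca_mul_linearl : forall m n (y : tca_rep n), linear (fun x => @tca_mul m n x y);
  tca_mulA : forall l m n (x : tca_rep l) (y : tca_rep m) (z : tca_rep n),
    gcast (addnA l m n) (tca_mul x (tca_mul y z)) = tca_mul (tca_mul x y) z;
  tca_mul1l : forall n (x : tca_rep n), gcast (add0n n) (tca_mul tca_one x) = x;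
  tca_mul1r : forall n (x : tca_rep n), gcast (addn0 n) (tca_mul x tca_one) = x;
  tca_mul_equiv : forall m n (s : 'S_m) (t : 'S_n) (x : tca_rep m) (y : tca_rep n),
    tca_mul (srep_act s x) (srep_act t y) = srep_act (osum s t) (tca_mul x y);
  tca_mulC : forall n m (x : tca_rep n) (y : tca_rep m),
    tca_mul x y = gcast (addnC m n) (srep_act (tau m n) (tca_mul y x)) }.

Record tca_module (k : fieldType) (R : tca k) := TcaModule {
  mod_rep :> srep k;
  mod_act : forall m n, R m -> mod_rep n -> mod_rep (m + n)%N;
  mod_act_linearr : forall m n (a : R m), linear (@mod_act m n a);
  mod_act_linearl : forall m n (x : mod_rep n), linear (fun a => @mod_act m n a x);
  mod_actA : forall l m n (a : R l) (b : R m) (x : mod_rep n),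
    gcast (addnA l m n) (mod_act a (mod_act b x)) = mod_act (tca_mul a b) x;
  mod_act1 : forall n (x : mod_rep n), gcast (add0n n) (mod_act (tca_one R) x) = x;
  mod_act_equiv : forall m n (s : 'S_m) (t : 'S_n) (a : R m) (x : mod_rep n),
    mod_act (srep_act s a) (srep_act t x) = srep_act (osum s t) (mod_act a x) }.

Section Generation.
Variable k : fieldType.

Definition helt (V : srep k) : Type := {n : nat & V n}.

Definition gsubset (V : srep k) : Type := forall n, set (V n).

(* Graded k-subspace stable under the symmetric groups. *)
Definition is_subrep (V : srep k) (P : gsubset V) : Prop :=
  [/\ forall n, P n 0,
      forall n (c : k) (x y : V n), P n x -> P n y -> P n (c *: x + y)
    & forall n (s : 'S_n) (x : V n), P n x -> P n (srep_act s x)].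

Definition is_subtca (R : tca k) (P : gsubset R) : Prop :=
  [/\ is_subrep P, P 0%N (tca_one R)
    & forall m n (x : R m) (y : R n), P m x -> P n y -> P (m + n)%N (tca_mul x y)].

Definition tca_generated_by (R : tca k) (S : set (helt R)) : Prop :=
  forall P : gsubset R, is_subtca P ->
    (forall h : helt R, S h -> P (tag h) (tagged h)) ->
    forall n (x : R n), P n x.

Definition tca_finitely_generated (R : tca k) : Prop :=
  exists S : set (helt R), finite_set S /\ tca_generated_by S.

Definition tca_generated_in_degree_le (R : tca k) (d : nat) : Prop :=
  exists S : set (helt R),
    (forall h : helt R, S h -> (tag h <= d)%N) /\ tca_generated_by S.

Section Modules.
Variables (R : tca k) (M : tca_module R).

Definition is_submodule (N : gsubset M) : Prop :=
  is_subrep N /\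
  forall m n (a : R m) (x : M n), N n x -> N (m + n)%N (mod_act a x).

Definition submodule_gen (S : set (helt M)) : gsubset M := fun n x =>
  forall N : gsubset M, is_submodule N ->
    (forall h : helt M, S h -> N (tag h) (tagged h)) -> N n x.

Definition submodule_fg (N : gsubset M) : Prop :=
  exists S : set (helt M),
    finite_set S /\ forall n (x : M n), N n x <-> submodule_gen S x.

Definition module_fg : Prop := submodule_fg (fun n => @setT (M n)).

End Modules.

Definition tca_noetherian (R : tca k) : Prop :=
  forall M : tca_module R, module_fg M ->
    forall N : gsubset M, is_submodule N -> submodule_fg N.

End Generation.

Section TensorAlgebra.
Variables (k : fieldType) (W : vectType k).
Local Notation I := 'I_(\dim {:W}).
Local Notation e := (vbasis {:W}).

(* The n-th tensor power of W, in coordinates: x : tpow n stands for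
   \sum_t x t *: (e_(t 0) ⊗ ... ⊗ e_(t (n-1))), where e is the basis of W
   chosen by the library and t ranges over the multi-indices {ffun 'I_n -> I}.
   [tens] below is the multilinear map (w_0, ..., w_(n-1)) |-> w_0 ⊗ ... ⊗ w_(n-1);
   all operations are computed on its values by the lemmas [t*_tens]. *)
Definition tpow (n : nat) : vectType k := {ffun {ffun 'I_n -> I} -> k^o}.

Definition tobj (n : nat) : lmodType k := tpow n.

Definition tens n (w : 'I_n -> W) : tpow n :=
  [ffun t : {ffun 'I_n -> I} => \prod_i coord e (t i) (w i)].

Definition tact n (s : 'S_n) (x : tpow n) : tpow n :=
  [ffun t : {ffun 'I_n -> I} => x [ffun i => t (s i)]].

Definition tone : tpow 0 := [ffun=> 1].

Definition tmul m n (x : tpow m) (y : tpow n) : tpow (m + n) :=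
  [ffun t : {ffun 'I_(m + n) -> I} =>
     x [ffun i => t (lshift n i)] * y [ffun j => t (rshift m j)]].

Definition tmap (g : 'End(W)) n (x : tpow n) : tpow n :=
  [ffun t : {ffun 'I_n -> I} =>
     \sum_(u : {ffun 'I_n -> I})
        (\prod_i coord e (t i) (g e`_(u i))) * x u].

Lemma tens_basis n (t : {ffun 'I_n -> I}) :
  tens (fun i => e`_(t i)) = [ffun u => (u == t)%:R].
Proof.
apply/ffunP=> u; rewrite !ffunE.
have co i : coord e (u i) e`_(t i) = (u i == t i)%:R.
  by rewrite coord_free ?(basis_free (vbasisP _)) // eq_sym.
under eq_bigr => i _ do rewrite co.
case: eqP => [->|ne]; first by rewrite big1 // => i _; rewrite eqxx.
have [i ni] : exists i, u i != t i.
  apply/existsP; rewrite -negb_forall; apply/negP => /forallP h.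
  by apply: ne; apply/ffunP => i; apply/eqP.
by rewrite (bigD1 i) //= (negbTE ni) mul0r.
Qed.

Lemma tens_decomp n (x : tpow n) :
  x = \sum_(t : {ffun 'I_n -> I}) x t *: tens (fun i => e`_(t i)).
Proof.
apply/ffunP => u; rewrite sum_ffunE (bigD1 u) //= big1 ?addr0.
  by rewrite tens_basis !ffunE eqxx; exact/esym/mulr1.
move=> t ne; rewrite tens_basis !ffunE eq_sym (negbTE ne); exact: mulr0.
Qed.

Lemma tens_multilinear n (j : 'I_n) (w : 'I_n -> W) (c : k) (a b : W) :
  let upd v i := if i == j then v else w i in
  tens (upd (c *: a + b)) = c *: tens (upd a) + tens (upd b).
Proof.
apply/ffunP => t; rewrite !ffunE /= !(bigD1 j (P := xpredT)) //= !eqxx.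
rewrite linearP mulrDl; congr (_ + _); last first.
  by congr (_ * _); apply: eq_bigr => i /negbTE ->.
rewrite -mulrA; congr (_ * (_ * _)).
by apply: eq_bigr => i /negbTE ->.
Qed.

Lemma tact_tens n (s : 'S_n) (w : 'I_n -> W) :
  tact s (tens w) = tens (fun i => w ((s^-1)%g i)).
Proof.
apply/ffunP => t; rewrite !ffunE [RHS](reindex_inj (@perm_inj _ s)) /=.
by apply: eq_bigr => i _; rewrite ffunE permK.
Qed.

Lemma tmul_tens m n (v : 'I_m -> W) (w : 'I_n -> W) :
  tmul (tens v) (tens w) =
  tens (fun i => match split i with inl a => v a | inr b => w b end).
Proof.
apply/ffunP => t; rewrite !ffunE big_split_ord /=.
congr (_ * _); apply: eq_bigr => i _.
  by rewrite ffunE (unsplitK (inl i)).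
by rewrite ffunE (unsplitK (inr i)).
Qed.

Lemma tone_tens (w : 'I_0 -> W) : tone = tens w.
Proof. by apply/ffunP => t; rewrite !ffunE big_ord0. Qed.

Lemma tmap_tens (g : 'End(W)) n (w : 'I_n -> W) :
  tmap g (tens w) = tens (fun i => g (w i)).
Proof.
apply/ffunP => t; rewrite !ffunE.
transitivity (\sum_(u : {ffun 'I_n -> I}) \prod_i (coord e (t i) (g e`_(u i)) * coord e (u i) (w i))).
  by apply: eq_bigr => u _; rewrite ffunE big_split.
rewrite -(bigA_distr_bigA
  (fun i (j : I) => coord e (t i) (g e`_j) * coord e j (w i))) /=.
apply: eq_bigr => i _.
rewrite {2}(coord_vbasis (memvf (w i))) !linear_sum /=.
by apply: eq_bigr => j _; rewrite !linearZ /= mulrC.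
Qed.

Lemma tact_linear n (s : 'S_n) : linear (@tact n s).
Proof. by move=> c x y; apply/ffunP => t; rewrite !ffunE. Qed.

Lemma tact1 n (x : tpow n) : tact 1%g x = x.
Proof.
by apply/ffunP => t; rewrite ffunE; congr (x _); apply/ffunP => i; rewrite ffunE perm1.
Qed.

Lemma tactM n (s t : 'S_n) (x : tpow n) : tact (s * t)%g x = tact t (tact s x).
Proof.
apply/ffunP => u; rewrite !ffunE; congr (x _).
by apply/ffunP => i; rewrite !ffunE permM.
Qed.

Definition tensor_srep : srep k :=
  @SRep k tobj tact tact_linear tact1 tactM.

Lemma tmul_linearr m n (x : tpow m) : linear (@tmul m n x).
Proof.
by move=> c y z; apply/ffunP => t; rewrite !ffunE mulrDr; congr (_ + _);
  exact: mulrCA.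
Qed.

Lemma tmul_linearl m n (y : tpow n) : linear (fun x => @tmul m n x y).
Proof.
by move=> c x z; apply/ffunP => t; rewrite !ffunE mulrDl; congr (_ + _);
  exact/esym/mulrA.
Qed.

Lemma gcast_tpow m n (E : m = n) (x : tpow m) (t : {ffun 'I_n -> I}) :
  gcast (V := tobj) E x t = x [ffun i => t (cast_ord E i)].
Proof.
case: n / E t => t /=; congr (x _); apply/ffunP => i.
by rewrite ffunE cast_ord_id.
Qed.

Lemma tmulA l m n (x : tpow l) (y : tpow m) (z : tpow n) :
  gcast (V := tobj) (addnA l m n) (tmul x (tmul y z)) = tmul (tmul x y) z.
Proof.
apply/ffunP => t; rewrite gcast_tpow !ffunE mulrA.
congr (_ * _ * _); [congr (x _) | congr (y _) | congr (z _)];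
  apply/ffunP => i; rewrite !ffunE; congr (t _); apply: val_inj => //=.
by rewrite addnA.
Qed.

Lemma tmul1l n (x : tpow n) : gcast (V := tobj) (add0n n) (tmul tone x) = x.
Proof.
apply/ffunP => t; rewrite gcast_tpow !ffunE mul1r; congr (x _).
by apply/ffunP => i; rewrite !ffunE; congr (t _); apply: val_inj.
Qed.

Lemma tmul1r n (x : tpow n) : gcast (V := tobj) (addn0 n) (tmul x tone) = x.
Proof.
apply/ffunP => t; rewrite gcast_tpow !ffunE mulr1; congr (x _).
by apply/ffunP => i; rewrite !ffunE; congr (t _); apply: val_inj.
Qed.

Lemma tmul_equiv m n (s : 'S_m) (t : 'S_n) (x : tpow m) (y : tpow n) :
  tmul (tact s x) (tact t y) = tact (osum s t) (tmul x y).
Proof.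
apply/ffunP => u; rewrite !ffunE.
congr (_ * _); [congr (x _) | congr (y _)]; apply/ffunP => i; rewrite !ffunE.
  by rewrite osum_lshift.
by rewrite osum_rshift.
Qed.

Lemma tmulC n m (x : tpow n) (y : tpow m) :
  tmul x y = gcast (V := tobj) (addnC m n) (tact (tau m n) (tmul y x)).
Proof.
apply/ffunP => u; rewrite gcast_tpow !ffunE mulrC.
congr (_ * _); [congr (y _) | congr (x _)]; apply/ffunP => i; rewrite !ffunE.
  by rewrite tau_lshift; congr (u _); apply: val_inj.
by rewrite tau_rshift; congr (u _); apply: val_inj.
Qed.

Definition tensor_tca : tca k :=
  @Tca k tensor_srep tone tmul tmul_linearr tmul_linearl tmulA tmul1l tmul1r
    tmul_equiv tmulC.

Lemma tmap_linear g n : linear (@tmap g n).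
Proof.
move=> c x y; apply/ffunP => t; rewrite !ffunE scaler_sumr -big_split /=.
apply: eq_bigr => u _; rewrite !ffunE mulrDr; congr (_ + _); exact: mulrCA.
Qed.

HB.instance Definition _ g n :=
  GRing.isLinear.Build k (tpow n) (tpow n) _ (@tmap g n) (@tmap_linear g n).

Lemma tmap_tone g : tmap g tone = tone.
Proof. by rewrite (tone_tens (fun=> 0)) tmap_tens -!tone_tens. Qed.

Lemma tmap_tact g n (s : 'S_n) (x : tpow n) :
  tmap g (tact s x) = tact s (tmap g x).
Proof.
apply/ffunP => t; rewrite !ffunE.
pose h (u : {ffun 'I_n -> I}) : {ffun 'I_n -> I} := [ffun i => u (s i)].
have h_inj : injective h.
  move=> u v /ffunP E; apply/ffunP => i.
  by have := E ((s^-1)%g i); rewrite !ffunE permKV.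
rewrite [RHS](reindex_inj h_inj) /=; apply: eq_bigr => u _.
rewrite ffunE; congr (_ * _).
rewrite [LHS](reindex_inj (@perm_inj _ s)) /=.
by apply: eq_bigr => i _; rewrite !ffunE.
Qed.

Lemma tmap_tmul g m n (x : tpow m) (y : tpow n) :
  tmap g (tmul x y) = tmul (tmap g x) (tmap g y).
Proof.
have mulsl J (P : seq J) (F : J -> tpow m) z :
    tmul (\sum_(j <- P) F j) z = \sum_(j <- P) tmul (F j) z :> tpow (m + n).
  elim: P => [|j P IH]; last first.
    by rewrite !big_cons -IH -[F j]scale1r tmul_linearl !scale1r.
  by rewrite !big_nil; apply/ffunP => t; rewrite !ffunE mul0r.
have mulsr J (P : seq J) (F : J -> tpow n) z :
    tmul z (\sum_(j <- P) F j) = \sum_(j <- P) tmul z (F j) :> tpow (m + n).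
  elim: P => [|j P IH]; last first.
    by rewrite !big_cons -IH -[F j]scale1r tmul_linearr !scale1r.
  by rewrite !big_nil; apply/ffunP => t; rewrite !ffunE mulr0.
have mulZl c (a : tpow m) (b : tpow n) : tmul (c *: a) b = c *: tmul a b.
  by apply/ffunP => t; rewrite !ffunE; exact/esym/mulrA.
have mulZr c (a : tpow m) (b : tpow n) : tmul a (c *: b) = c *: tmul a b.
  by apply/ffunP => t; rewrite !ffunE; exact: mulrCA.
rewrite [x]tens_decomp [y]tens_decomp.
rewrite mulsl !linear_sum /= mulsl; apply: eq_bigr => t _.
rewrite mulsr !linear_sum /= mulsr; apply: eq_bigr => u _.
rewrite mulZl mulZr !linearZ /= mulZl mulZr !tmap_tens !tmul_tens.
rewrite tmap_tens; congr (_ *: (_ *: _)).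
apply/ffunP => v; rewrite !ffunE; apply: eq_bigr => i _.
by case: (split i).
Qed.

Variable G : {fset 'End(W)}.

Definition tinv (n : nat) : {vspace tpow n} :=
  (\bigcap_(g <- enum_fset G) fixedSpace (linfun (@tmap g n)))%VS.

Lemma tinvP n (x : tpow n) :
  reflect {in G, forall g, tmap g x = x} (x \in tinv n).
Proof.
rewrite /tinv; apply: (iffP idP) => [xG g gG | xG].
  apply/eqP; rewrite -(lfunE (@tmap g n)); apply/eqP/fixedSpaceP.
  by move: xG; rewrite (big_rem g) //= memv_cap => /andP[].
rewrite big_seq; elim/big_ind: _ => [|U V xU xV|g gG]; first exact: memvf.
  by rewrite memv_cap xU.
by apply/fixedSpaceP; rewrite lfunE /= xG.
Qed.

Definition inv_obj (n : nat) : lmodType k := subvs_of (tinv n).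

Lemma tact_inv n (s : 'S_n) (x : inv_obj n) : tact s (vsval x) \in tinv n.
Proof. by apply/tinvP => g gG; rewrite tmap_tact (tinvP _ (subvsP x)). Qed.

Definition inv_act n (s : 'S_n) (x : inv_obj n) : inv_obj n :=
  Subvs (tact_inv s x).

Lemma tone_inv : tone \in tinv 0.
Proof. by apply/tinvP => g _; rewrite tmap_tone. Qed.

Definition inv_one : inv_obj 0 := Subvs tone_inv.

Lemma tmul_inv m n (x : inv_obj m) (y : inv_obj n) :
  tmul (vsval x) (vsval y) \in tinv (m + n).
Proof.
by apply/tinvP => g gG; rewrite tmap_tmul !(tinvP _ (subvsP _)).
Qed.

Definition inv_mul m n (x : inv_obj m) (y : inv_obj n) : inv_obj (m + n) :=
  Subvs (tmul_inv x y).

Lemma vsval_gcast m n (E : m = n) (x : inv_obj m) :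
  vsval (gcast (V := inv_obj) E x) = gcast (V := tobj) E (vsval x).
Proof. by case: n / E. Qed.

Lemma inv_act_linear n (s : 'S_n) : linear (@inv_act n s).
Proof. by move=> c x y; apply: val_inj; exact: tact_linear. Qed.

Lemma inv_act1 n (x : inv_obj n) : inv_act 1%g x = x.
Proof. by apply: val_inj; exact: tact1. Qed.

Lemma inv_actM n (s t : 'S_n) (x : inv_obj n) :
  inv_act (s * t)%g x = inv_act t (inv_act s x).
Proof. by apply: val_inj; exact: tactM. Qed.

Definition invariant_srep : srep k :=
  @SRep k inv_obj inv_act inv_act_linear inv_act1 inv_actM.

Lemma inv_mul_linearr m n (x : inv_obj m) : linear (@inv_mul m n x).
Proof. by move=> c y z; apply: val_inj; exact: tmul_linearr. Qed.

Lemma inv_mul_linearl m n (y : inv_obj n) : linear (fun x => @inv_mul m n x y).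
Proof. by move=> c x z; apply: val_inj; exact: (tmul_linearl (vsval y)). Qed.

Lemma inv_mulA l m n (x : inv_obj l) (y : inv_obj m) (z : inv_obj n) :
  gcast (V := inv_obj) (addnA l m n) (inv_mul x (inv_mul y z)) =
  inv_mul (inv_mul x y) z.
Proof. by apply: val_inj => /=; rewrite vsval_gcast; exact: tmulA. Qed.

Lemma inv_mul1l n (x : inv_obj n) :
  gcast (V := inv_obj) (add0n n) (inv_mul inv_one x) = x.
Proof. by apply: val_inj => /=; rewrite vsval_gcast; exact: tmul1l. Qed.

Lemma inv_mul1r n (x : inv_obj n) :
  gcast (V := inv_obj) (addn0 n) (inv_mul x inv_one) = x.
Proof. by apply: val_inj => /=; rewrite vsval_gcast; exact: tmul1r. Qed.

Lemma inv_mul_equiv m n (s : 'S_m) (t : 'S_n) (x : inv_obj m) (y : inv_obj n) :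
  inv_mul (inv_act s x) (inv_act t y) = inv_act (osum s t) (inv_mul x y).
Proof. by apply: val_inj; exact: tmul_equiv. Qed.

Lemma inv_mulC n m (x : inv_obj n) (y : inv_obj m) :
  inv_mul x y =
  gcast (V := inv_obj) (addnC m n) (inv_act (tau m n) (inv_mul y x)).
Proof. by apply: val_inj => /=; rewrite vsval_gcast; exact: tmulC. Qed.

Definition invariant_tca : tca k :=
  @Tca k invariant_srep inv_one inv_mul inv_mul_linearr inv_mul_linearl
    inv_mulA inv_mul1l inv_mul1r inv_mul_equiv inv_mulC.

End TensorAlgebra.

Definition finite_subgroup_GL (k : fieldType) (W : vectType k)
    (G : {fset 'End(W)}) : Prop :=
  [/\ \1%VF \in G,
      {in G &, forall g h, (g \o h)%VF \in G}
    & {in G, forall g, lker g = 0%VS /\ (g^-1)%VF \in G}].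

Definition has_characteristic (k : fieldType) (p : nat) : Prop :=
  (p = 0%N /\ [pchar k] =i pred0) \/ p \in [pchar k].

(* Main.v *)
From HB Require Import structures.
Require Import Defs.
From mathcomp Require Import all_boot all_order all_fingroup all_algebra.
From mathcomp Require Import pgroup zify ring.
From mathcomp Require Import finmap.
From mathcomp Require Import boolp classical_sets cardinality.

(** Generation when [#|G|] is invertible: expanding the products
    [\prod_i (w_i - h (g_i w_i)) = 0] over [h : G] and summing (Fogarty, Benson)
    expresses a tensor of degree at least [#|G|] through tensors with an invariant
    factor of degree between [1] and [#|G|]; the Reynolds operator turns this into
    a decomposition of invariants.

    Noetherianity: a free module over the tensor algebra has a basis of words in
    which finitely many labels occur, and inserting unlabelled letters is a well
    quasi-order on them (Higman), so leading words show that a set of formal sums of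
    words is generated, under insertions, by a finite subset.  Given a module [M]
    over the invariants, this is applied to the lifts of a submodule of [M]; the
    insertions act on [M] through the Reynolds operator.

    Modular case: an element of order [p] of [G] is unipotent, which gives linear
    forms [l] and [m] on [W], [m] nonzero, with [l \o g = l + m] and [m \o g = m].
    Comparing the values of an invariant at [(l, m, ..., m)] and at
    [(l \o g, m, ..., m)] shows that it vanishes at [(m, ..., m)].  Hence if the
    generators have degree at most [D], a nonzero value of an invariant of degree
    [n] needs at least [n / D] arguments other than [m]; but some sums over [G] of
    translated tensors, of arbitrarily large degree, need at most [#|G|]. *)

Set Implicit Arguments.
Unset Strict Implicit.
Unset Printing Implicit Defensive.

Import GRing.Theory.

(** * Words and formal sums of words *)

Section Higman.
Variables (J : finType) (isI : pred J).
Implicit Types s t u : seq J.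

Inductive emb : seq J -> seq J -> Prop :=
| emb_nil : emb [::] [::]
| emb_cons c s t : emb s t -> emb (c :: s) (c :: t)
| emb_ins c s t : isI c -> emb s t -> emb s (c :: t).

Lemma emb_refl s : emb s s.
Proof. by elim: s => [|c s IH]; constructor. Qed.

Lemma emb_trans s t u : emb s t -> emb t u -> emb s u.
Proof.
move=> st tu; elim: tu s st => {t u} [//|c t u tu IH s st|c t u Ic tu IH s st].
  by inversion st; subst; constructor=> //; apply: IH.
by apply: emb_ins => //; apply: IH.
Qed.

Lemma emb_count s t : emb s t -> count (predC isI) t = count (predC isI) s.
Proof. by elim=> //= [c {}s {}t _ ->|c {}s {}t -> _ ->]. Qed.

Definition finite_basis (P : set (seq J)) :=
  exists B : seq (seq J), (forall b, b \in B -> P b) /\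
    forall w, P w -> exists2 b, b \in B & emb b w.

Definition upclosed (U : set (seq J)) := forall s t, U s -> emb s t -> U t.

Lemma finite_basis_upclosure (P : set (seq J)) :
  finite_basis (fun t => exists2 s, P s & emb s t) -> finite_basis P.
Proof.
case=> B [BP Bdom].
have /choice[f fP] b : exists s, b \in B -> P s /\ emb s b.
  have [bB|bB] := boolP (b \in B); last by exists [::].
  by have [s Ps sb] := BP b bB; exists s.
exists [seq f b | b <- B]; split=> [_ /mapP[b bB ->]|w Pw].
  by have [] := fP b bB.
have [|b bB bw] := Bdom w; first by exists w => //; apply: emb_refl.
exists (f b); first exact: map_f.
by apply: emb_trans bw; have [] := fP b bB.
Qed.

Definition shiftl (c : J) (U : set (seq J)) : set (seq J) := fun w => U (c :: w).

(* If [shiftl c U `<=` U], a leading letter [c] can be deleted within [U]. *)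
Lemma finite_basis_shiftl (U : set (seq J)) : upclosed U ->
  (forall c, (isI c /\ shiftl c U `<=` U)%classic \/ finite_basis (shiftl c U)) ->
  finite_basis U.
Proof.
move=> Uup Uc.
have /choice[B BP] c : exists B : seq (seq J), (forall b, b \in B -> U (c :: b)) /\
    ((isI c /\ shiftl c U `<=` U)%classic \/
     forall w, U (c :: w) -> exists2 b, b \in B & emb b w).
  by case: (Uc c) => [h|[B [? ?]]]; [exists [::]; split=> //; left | exists B; split=> //; right].
pose B0 : seq (seq J) := if `[< U [::] >] then [:: [::]] else [::].
exists (B0 ++ flatten [seq [seq c :: b | b <- B c] | c <- enum J]).
split=> [b|].
  rewrite mem_cat => /orP[|/flatten_mapP[c _ /mapP[b' b'B ->]]]; last first.
    by apply: (BP c).1.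
  by rewrite /B0; case: asboolP => // U0; rewrite inE => /eqP ->.
elim=> [|c w IH] Uw.
  exists [::]; last exact: emb_refl.
  by rewrite mem_cat /B0; case: asboolP.
have [_ [[Ic UcU]|/(_ w Uw)[b bB bw]]] := BP c.
  by have [b bB bw] := IH (UcU _ Uw); exists b => //; apply: emb_ins.
exists (c :: b); last exact: emb_cons.
rewrite mem_cat; apply/orP; right; apply/flatten_mapP.
by exists c; rewrite ?mem_enum ?map_f.
Qed.

Definition few_labels D (U : set (seq J)) :=
  forall w, U w -> (count (predC isI) w <= D)%N.

(* A maximal upward closed set without finite basis satisfies the hypotheses of
   [finite_basis_shiftl]: if [isI c] then [U `<=` shiftl c U], and otherwise the
   words of [shiftl c U] have fewer labels. *)
Lemma higman D (P : set (seq J)) : few_labels D P -> finite_basis P.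
Proof.
have [n] := ubnP D; elim: n D P => // n IHn D P0 leDn P0D.
apply: finite_basis_upclosure.
set U0 := (X in finite_basis X).
have U0D : few_labels D U0.
  by move=> w [s /P0D sD sw]; rewrite (emb_count sw).
have U0up : upclosed U0.
  by move=> s t [r Pr rs] st; exists r => //; apply: emb_trans st.
apply: contrapT => U0fb.
pose bad U := [/\ upclosed U, few_labels D U & finite_basis U -> U = set0].
have [|A [[Aup AD Afb] Amax]] := @Zorn_bigcup _ bad.
  move=> F Fbad Ftot; split.
  - by move=> s t [X FX Xs] st; exists X => //; have [up _ _] := Fbad X FX; apply: up st.
  - by move=> w [X FX Xw]; have [_ XD _] := Fbad X FX; apply: XD.
  move=> [B [BF Bdom]]; apply: contrapT => nF0.
  have [w [X FX Xw]] : exists w, (\bigcup_(X in F) X)%classic w.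
    apply: contrapT => nw; apply: nF0; apply/seteqP; split=> // w Fw.
    by case: nw; exists w.
  have [Y FY YB] : exists2 Y, F Y & Y w /\ forall b, b \in B -> Y b.
    elim: B BF {Bdom} => [|b B IH] BF; first by exists X.
    have [|Y FY [Yw YB]] := IH; first by move=> b' b'B; apply: BF; rewrite inE b'B orbT.
    have [Z FZ Zb] := BF b (mem_head _ _).
    have [YZ|ZY] := Ftot Y Z FY FZ.
      exists Z => //; split=> [|b']; first exact: YZ.
      by rewrite inE => /orP[/eqP ->//|/YB]; apply: YZ.
    exists Y => //; split=> // b'.
    by rewrite inE => /orP[/eqP ->|/YB//]; apply: ZY.
  have [_ _ Yfb] := Fbad Y FY.
  have /Yfb Y0 : finite_basis Y.
    exists B; split=> [b|v Yv]; first by have [_] := YB; apply.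
    by apply: Bdom; exists Y.
  by have [] := YB; rewrite Y0.
have Anfb : ~ finite_basis A.
  move=> /Afb A0; apply: (Amax U0); last by split.
  rewrite A0; split=> // U00; apply: U0fb.
  by exists [::]; split=> // w /U00.
apply: Anfb; apply: finite_basis_shiftl => // c.
have [Ic|nIc] := boolP (isI c); last first.
  right; case: D leDn AD {P0D U0D bad Afb Amax U0fb} => [|D] leDn AD.
    by exists [::]; split=> // w /AD /=; rewrite nIc.
  by apply: (IHn D) => // w /AD /=; rewrite nIc.
have AcA : (A `<=` shiftl c A)%classic.
  by move=> w Aw; apply: Aup Aw _; apply: emb_ins => //; apply: emb_refl.
have [cAA|ncAA] := pselect (shiftl c A `<=` A)%classic; [by left | right].
apply: contrapT => nfb; apply: (Amax (shiftl c A)) => //; split=> //.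
- by move=> s t; rewrite /shiftl => As st; apply: Aup As _; apply: emb_cons.
- by move=> w /AD /=; rewrite Ic.
Qed.
End Higman.

Section Insertion.
Variables (K J : finType) (isI : pred J).

Definition ins p (c : J) (s : seq J) := take p s ++ c :: drop p s.

Lemma size_ins p c s : size (ins p c s) = (size s).+1.
Proof. by rewrite size_cat /= addnS -size_cat cat_take_drop. Qed.

Lemma count_ins (a : pred J) p c s : count a (ins p c s) = (a c + count a s)%N.
Proof. by rewrite count_cat /= addnCA -count_cat cat_take_drop. Qed.

Lemma ins_inj p c s t : size s = size t -> ins p c s = ins p c t -> s = t.
Proof.
move=> st /eqP; rewrite /ins eqseq_cat ?size_take ?st // => /andP[/eqP e1].
by rewrite eqseq_cons eqxx => /eqP e2; rewrite -(cat_take_drop p s) e1 e2 cat_take_drop.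
Qed.

Fixpoint word_code (s : seq J) : nat :=
  if s is c :: t then (enum_rank c * #|J| ^ size t + word_code t)%N else 0.

Lemma word_code_lt s : (word_code s < #|J| ^ size s)%N.
Proof.
elim: s => [|c s IH]; first by rewrite expn0.
rewrite /= expnS (leq_trans (_ : _ < (enum_rank c).+1 * #|J| ^ size s)%N) //.
  by rewrite mulSn addnC ltn_add2r.
by rewrite leq_mul2r ltn_ord orbT.
Qed.

Lemma lex_lt q a b x y : (x < q)%N -> (y < q)%N ->
  (a * q + x < b * q + y)%N = (a < b)%N || (a == b) && (x < y)%N.
Proof. move=> xq yq; case: (ltngtP a b) => [ab|ab|->] /=; [nia|nia|by rewrite ltn_add2l]. Qed.

Lemma word_code_cons c d s t : size s = size t ->
  (word_code (c :: s) < word_code (d :: t))%N =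
  (enum_rank c < enum_rank d)%N || (c == d) && (word_code s < word_code t)%N.
Proof.
move=> st /=; rewrite -st lex_lt ?word_code_lt //; last by rewrite st word_code_lt.
by congr (_ || (_ && _)); rewrite -(inj_eq enum_rank_inj).
Qed.

Lemma word_code_inj s t : size s = size t -> word_code s = word_code t -> s = t.
Proof.
elim: s t => [|c s IH] [|d t] //= [st] e.
have h1 := word_code_cons c d st; have h2 := word_code_cons d c (esym st).
move: h1 h2; rewrite /= e ltnn => /esym/negbT + /esym/negbT.
rewrite !negb_or -!leqNgt => /andP[dc _] /andP[cd _].
have ecd : c = d by apply/enum_rank_inj/val_inj/eqP; rewrite eqn_leq cd.
by rewrite ecd in e *; congr (_ :: _); apply: IH => //; move: e; rewrite st => /addnI.
Qed.

Lemma word_code_ins p c s t : size s = size t ->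
  (word_code s < word_code t)%N -> (word_code (ins p c s) < word_code (ins p c t))%N.
Proof.
elim: p s t => [|p IH] [|a s] [|b t] // [st] lt_st.
  by rewrite -[ins _ _ _]/(c :: a :: s) -[ins _ _ (b :: t)]/(c :: b :: t) word_code_cons ?lt_st ?eqxx ?orbT //= st.
rewrite -[ins _ _ (a :: s)]/(a :: ins p c s) -[ins _ _ (b :: t)]/(b :: ins p c t).
move: lt_st; rewrite !word_code_cons ?size_ins ?st //.
by case/orP => [->//|/andP[-> /(IH _ _ st) ->]]; rewrite orbT.
Qed.

Definition word_rank (b : K * seq J) := (enum_rank b.1 * #|J| ^ size b.2 + word_code b.2)%N.

Definition insb p c (b : K * seq J) := (b.1, ins p c b.2).

Lemma word_rank_inj b b' : size b.2 = size b'.2 -> word_rank b = word_rank b' -> b = b'.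
Proof.
case: b b' => [i s] [j t] /= st e; rewrite /word_rank /= st in e.
have /= := lex_lt (enum_rank i) (enum_rank j) (word_code_lt s) (_ : word_code t < _)%N.
have /= := lex_lt (enum_rank j) (enum_rank i) (_ : word_code t < _)%N (word_code_lt s).
rewrite st word_code_lt e !ltnn => /(_ isT)/esym/negbT + /(_ isT)/esym/negbT.
rewrite !negb_or -!leqNgt => /andP[ij _] /andP[ji _].
have eij : i = j by apply/enum_rank_inj/val_inj/eqP; rewrite eqn_leq ij.
by rewrite eij in e *; congr (_, _); apply: word_code_inj => //; apply: addnI e.
Qed.

Lemma word_rank_insb p c b b' : size b.2 = size b'.2 ->
  (word_rank b < word_rank b')%N -> (word_rank (insb p c b) < word_rank (insb p c b'))%N.
Proof.
case: b b' => [i s] [j t] /= st; rewrite /word_rank /= !size_ins st.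
have lt_enc r : (word_code (ins p c r) < #|J| ^ (size r).+1)%N by rewrite -(size_ins p c) word_code_lt.
rewrite !lex_lt ?lt_enc ?word_code_lt //; try by rewrite -st ?word_code_lt ?lt_enc.
by case/orP => [->//|/andP[-> /(word_code_ins p c st) ->]]; rewrite orbT.
Qed.

Lemma insb_inj p c b b' : size b.2 = size b'.2 -> insb p c b = insb p c b' -> b = b'.
Proof. by case: b b' => [i s] [j t] /= st [-> /(ins_inj st) ->]. Qed.

Inductive reach b : K * seq J -> Prop :=
| reach_refl : reach b b
| reach_ins p c b' : (p <= size b'.2)%N -> isI c -> reach b b' -> reach b (insb p c b').

Lemma emb_reach i s t : emb isI s t -> reach (i, s) (i, t).
Proof.
elim=> {s t} [|c s t _ IH|c s t Ic _ IH]; first exact: reach_refl.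
  have: forall b, reach (i, s) b -> reach (i, c :: s) (b.1, c :: b.2).
    by move=> b; elim=> [|p d b' le Id _ IH']; [exact: reach_refl|exact: (@reach_ins _ p.+1 d _ _ Id IH')].
  by move/(_ _ IH).
have /= := @reach_ins (i, s) 0 c (i, t) (leq0n _) Ic IH.
by rewrite /insb /ins /= take0 drop0.
Qed.

Lemma reach_basis D (P : set (K * seq J)) :
  (forall b, P b -> count (predC isI) b.2 <= D)%N ->
  exists B : seq (K * seq J), (forall b, b \in B -> P b) /\
    forall b, P b -> exists2 b', b' \in B & reach b' b.
Proof.
move=> PD.
have /choice[B BP] i : finite_basis isI (fun s => P (i, s)).
  by apply: (@higman _ _ D) => s /PD.
exists (flatten [seq [seq (i, s) | s <- B i] | i <- enum K]); split.
  by move=> b /flatten_mapP[i _ /mapP[s /(BP i).1 Ps ->]].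
move=> [i s] /((BP i).2 s)[t tB ts]; exists (i, t); last exact: emb_reach.
by apply/flatten_mapP; exists i; rewrite ?mem_enum ?map_f.
Qed.
End Insertion.

Section Groebner.
Local Open Scope ring_scope.
Variables (k : fieldType) (K J : finType) (isI : pred J) (D : nat).
Local Notation B := (K * seq J)%type.
(* A list [x : seq (k * B)] stands for the formal linear combination of its entries. *)
Implicit Types (x y : seq (k * B)) (b : B) (P : nat -> seq (k * B) -> Prop).

Definition coef x b : k := \sum_(z <- x | z.2 == b) z.1.

Definition mapb (f : B -> B) x : seq (k * B) := [seq (z.1, f z.2) | z <- x].

Definition scal (a : k) x : seq (k * B) := [seq (a * z.1, z.2) | z <- x].

Definition homog n x :=
  all (fun z : k * B => (size z.2.2 == n) && (count (predC isI) z.2.2 <= D)%N) x.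

Inductive ins_span P : nat -> seq (k * B) -> Prop :=
| ins_span_gen n x : P n x -> ins_span P n x
| ins_span_nil n : ins_span P n [::]
| ins_span_lin n a x y : ins_span P n x -> ins_span P n y -> ins_span P n (scal a x ++ y)
| ins_span_ins n p c x : (p <= n)%N -> isI c -> ins_span P n x ->
    ins_span P n.+1 (mapb (insb p c) x)
| ins_span_eq n x y : coef x =1 coef y -> homog n y -> ins_span P n x -> ins_span P n y.

Lemma coef_lin a x y b : coef (scal a x ++ y) b = a * coef x b + coef y b.
Proof. by rewrite /coef big_cat big_map /= -big_distrr. Qed.

Lemma coef_nil b : coef [::] b = 0.
Proof. by rewrite /coef big_nil. Qed.

Lemma coef_neq0 x b : coef x b != 0 -> exists a, (a, b) \in x.
Proof.
rewrite /coef; elim: x => [|[a b'] x IH]; first by rewrite big_nil eqxx.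
rewrite big_cons /=; have [<- _|_ /IH[a' h]] := eqVneq b' b.
  by exists a; rewrite mem_head.
by exists a'; rewrite inE h orbT.
Qed.

Lemma homog_coef n x b : homog n x -> coef x b != 0 ->
  size b.2 = n /\ (count (predC isI) b.2 <= D)%N.
Proof. by move=> /allP xn /coef_neq0[a /xn/andP[/eqP]]. Qed.

Lemma homog_lin n a x y : homog n x -> homog n y -> homog n (scal a x ++ y).
Proof. by move=> xn yn; rewrite /homog all_cat all_map; apply/andP. Qed.

Lemma homog_ins n p c x : isI c -> homog n x -> homog n.+1 (mapb (insb p c) x).
Proof.
move=> Ic /allP xn; apply/allP => _ /mapP[z /xn/andP[zn zD] ->] /=.
by rewrite size_ins eqSS zn count_ins /= Ic.
Qed.

Lemma ins_span_homog P n x : (forall n x, P n x -> homog n x) -> ins_span P n x -> homog n x.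
Proof.
move=> Pn; elim=> {n x} // [n a x y _ + _|n p c x _ Ic _].
  exact: homog_lin.
exact: homog_ins.
Qed.

Lemma ins_span_mono P P' n x : (forall n x, P n x -> P' n x) -> ins_span P n x -> ins_span P' n x.
Proof.
move=> PP'; elim=> {n x} [n x /PP'||||].
- exact: ins_span_gen.
- exact: ins_span_nil.
- by move=> *; apply: ins_span_lin.
- by move=> *; apply: ins_span_ins.
by move=> n x y e yn _; apply: ins_span_eq.
Qed.

Definition mems (S : seq (nat * seq (k * B))) n x : Prop := (n, x) \in S.

Definition all_in P (S : seq (nat * seq (k * B))) := forall z, z \in S -> P z.1 z.2.

Lemma ins_span_compact P n x : ins_span P n x ->
  exists2 S, all_in P S & ins_span (mems S) n x.
Proof.
elim=> {n x} [n x Px|n|n a x y _ [S SP Sx] _ [S' SP' Sy]|n p c x pn Ic _ [S SP Sx]|n x y e yn _ [S SP Sx]].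
- exists [:: (n, x)]; last by apply: ins_span_gen; rewrite /mems mem_head.
  by move=> z; rewrite inE => /eqP ->.
- by exists [::] => //; apply: ins_span_nil.
- exists (S ++ S'); first by move=> z; rewrite mem_cat => /orP[/SP|/SP'].
  by apply: ins_span_lin; [apply: ins_span_mono Sx | apply: ins_span_mono Sy] => m z;
    rewrite /mems mem_cat => ->; rewrite ?orbT.
- by exists S => //; apply: ins_span_ins.
by exists S => //; apply: ins_span_eq Sx.
Qed.

Lemma coef_insb n p c x b : homog n x -> size b.2 = n ->
  coef (mapb (insb p c) x) (insb p c b) = coef x b.
Proof.
move=> /allP xn bn; rewrite /coef big_map /= [LHS]big_seq_cond [RHS]big_seq_cond.
apply: eq_bigl => z; case: (boolP (z \in x)) => //= /xn/andP[/eqP zn _].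
by apply/eqP/eqP => [/insb_inj->//|->//]; rewrite zn bn.
Qed.

Definition lead x b := coef x b != 0 /\
  forall b', coef x b' != 0 -> (word_rank b' <= word_rank b)%N.

Lemma lead_insb n p c x b : homog n x -> lead x b ->
  lead (mapb (insb p c) x) (insb p c b).
Proof.
move=> xn [xb xmax]; have [bn _] := homog_coef xn xb.
split=> [|b' /[dup] xb' /coef_neq0[a /mapP[z zx [_ eb']]]].
  by rewrite (coef_insb _ _ xn).
have /andP[/eqP zn _] := allP xn z zx.
move: xb'; rewrite eb' (coef_insb _ _ xn) // => /xmax.
rewrite leq_eqVlt => /orP[/eqP/word_rank_inj->//|/word_rank_insb/ltnW]; first by rewrite zn bn.
by apply; rewrite zn bn.
Qed.

Lemma lead_exists x : ~ coef x =1 (fun=> 0) -> exists b, lead x b.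
Proof.
move=> xN0.
have [b xb] : exists b, coef x b != 0.
  by apply: contrapT => h; apply: xN0 => b; apply/eqP; apply: contrapT => /negP ?; case: h; exists b.
pose Q n := `[< exists b, coef x b != 0 /\ word_rank b = n >].
have exQ : exists n, Q n by exists (word_rank b); apply/asboolP; exists b.
have [n Qn|_ /asboolP[b' [xb' <-]] bmax] := @ex_maxnP Q (\max_(z <- x) word_rank z.2) exQ.
  move/asboolP: Qn => [b' [/coef_neq0[a h] <-]].
  by rewrite (big_rem _ h) leq_maxl.
by exists b'; split=> // b'' xb''; apply: bmax; apply/asboolP; exists b''.
Qed.

Lemma lead_reach P n x b b' : (forall n x, P n x -> homog n x) ->
  ins_span P n x -> lead x b -> reach isI b b' ->
  exists2 x', ins_span P (size b'.2) x' & lead x' b'.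
Proof.
move=> Pn Px xb; elim=> [|p c {}b' pb' Ic _ [x' Px' xb']].
  exists x => //; have xn := ins_span_homog Pn Px.
  by have [-> _] := homog_coef xn xb.1.
exists (mapb (insb p c) x'); first by rewrite size_ins; apply: ins_span_ins.
by apply: lead_insb xb'; apply: ins_span_homog Px'.
Qed.

Theorem groebner P : (forall n x, P n x -> homog n x) ->
  exists2 S, all_in P S & forall n x, P n x -> ins_span (mems S) n x.
Proof.
move=> Pn.
have LTD b : (exists n x, ins_span P n x /\ lead x b) -> (count (predC isI) b.2 <= D)%N.
  by move=> [n [x [/(ins_span_homog Pn) xn [xb _]]]]; have [] := homog_coef xn xb.
have [L [LP Ldom]] := reach_basis LTD.
have [S SP SL] : exists2 S, all_in P S &
    forall b, b \in L -> exists n x, ins_span (mems S) n x /\ lead x b.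
  elim: L LP {Ldom} => [|b L IH] LP; first by exists [::].
  have [b' h|S SP SL] := IH; first by apply: LP; rewrite inE h orbT.
  have [n [x [Px xb]]] := LP b (mem_head _ _).
  have [S' SP' Sx] := ins_span_compact Px.
  exists (S ++ S'); first by move=> z; rewrite mem_cat => /orP[/SP|/SP'].
  move=> b'; rewrite inE => /orP[/eqP ->|/SL[m [y [Sy yb']]]]; [exists n, x|exists m, y];
    (split=> //; [apply: (ins_span_mono _ Sx) || apply: (ins_span_mono _ Sy)]) => i z;
    by rewrite /mems mem_cat => ->; rewrite ?orbT.
exists S => // n x /ins_span_gen.
have Sn m z : mems S m z -> homog m z by move/SP/Pn.
have SsP m z : ins_span (mems S) m z -> ins_span P m z.
  by apply: ins_span_mono => i w /SP.
suff: forall r x, ins_span P n x -> (forall b, coef x b != 0 -> (word_rank b < r)%N) ->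
    ins_span (mems S) n x.
  move=> h Px; have xn := ins_span_homog Pn Px.
  apply: (h (\max_(z <- x) word_rank z.2).+1) => // b /coef_neq0[a ab].
  by rewrite ltnS (big_rem _ ab) leq_maxl.
elim=> {x} [|r IH] x Px xr.
  apply: ins_span_eq (ins_span_nil _ _) => [b|]; last exact: ins_span_homog Px.
  rewrite coef_nil; apply/esym/eqP; apply: contrapT => /negP /xr.
  by [].
have xn := ins_span_homog Pn Px.
have [x0|/lead_exists[b xb]] := pselect (coef x =1 (fun=> 0)).
  by apply: ins_span_eq (ins_span_nil _ _) => // b; rewrite coef_nil x0.
have [b' b'L b'b] : exists2 b', b' \in L & reach isI b' b by apply: Ldom; exists n, x.
have [m [y [Sy yb']]] := SL b' b'L.
have [y' Sy' yb] := lead_reach Sn Sy yb' b'b.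
have [bn _] := homog_coef xn xb.1; rewrite bn in Sy'.
have y'n := ins_span_homog Sn Sy'.
set a := coef x b / coef y' b.
set z := scal (- a) y' ++ x.
have zn : homog n z by apply: homog_lin.
have Sz : ins_span (mems S) n z.
  apply: IH => [|b'']; first by apply: ins_span_lin => //; apply: SsP.
  rewrite coef_lin => h.
  have h' : (word_rank b'' <= word_rank b)%N.
    apply: contraLR h; rewrite -ltnNge negbK => lt_b.
    have -> : coef y' b'' = 0 by apply/eqP; apply: contraTT lt_b; rewrite -leqNgt => /yb.2.
    have -> : coef x b'' = 0 by apply/eqP; apply: contraTT lt_b; rewrite -leqNgt => /xb.2.
    by rewrite mulr0 addr0.
  have b''n : size b''.2 = n.
    have [] := homog_coef (b := b'') zn; last by [].
    by rewrite coef_lin.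
  suff neq : word_rank b'' != word_rank b.
    have : (word_rank b'' < word_rank b)%N by rewrite ltn_neqAle neq.
    by move=> /leq_trans; apply; rewrite -ltnS; apply: xr; case: xb.
  apply: contraNneq h => /word_rank_inj ->; last by rewrite b''n bn.
  by rewrite /a mulNr divfK ?addNr //; case: yb.
apply: ins_span_eq (ins_span_lin a Sy' Sz) => [b''|//].
by rewrite !coef_lin mulNr addNKr.
Qed.
End Groebner.

Lemma extend_inj n N (f : 'I_n -> 'I_N) : injective f ->
  exists l (E : (l + n)%N = N) (s : 'S_N), forall b, s (cast_ord E (rshift l b)) = f b.
Proof.
move=> f_inj; have nN : (n <= N)%N by have := leq_card f f_inj; rewrite !card_ord.
exists (N - n)%N, (subnK nN).
have cA : #|~: [set f b | b : 'I_n]| = (N - n)%N.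
  by rewrite cardsCs finset.setCK card_imset // !card_ord.
pose h (i : 'I_(N - n + n)) := match split i with
  | inl a => enum_val (cast_ord (esym cA) a) | inr b => f b end.
have hA a b : enum_val (cast_ord (esym cA) a) != f b.
  by apply: contraTneq (enum_valP (cast_ord (esym cA) a)) => ->; rewrite inE negbK imset_f.
have h_inj : injective h.
  move=> i j; rewrite /h; case: split_ordP => a ->; case: split_ordP => b ->.
  - by move/enum_val_inj/cast_ord_inj => ->.
  - by move/eqP; rewrite (negbTE (hA _ _)).
  - by move/esym/eqP; rewrite (negbTE (hA _ _)).
  by move/f_inj => ->.
have h'_inj : injective (fun i => h (cast_ord (esym (subnK nN)) i)).
  by move=> i j /h_inj/cast_ord_inj.
exists (perm h'_inj) => b.
by rewrite permE cast_ordK /h (unsplitK (inr b)).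
Qed.

(** * The Reynolds operator and the degree bound *)

Section Reynolds.
Local Open Scope ring_scope.
Variables (k : fieldType) (W : vectType k) (G : {fset 'End(W)}).
Hypothesis Gsub : finite_subgroup_GL G.

Lemma tmapM (g h : 'End(W)) n (x : tpow W n) : tmap g (tmap h x) = tmap (g \o h)%VF x.
Proof.
rewrite [x]tens_decomp !linear_sum /=; apply: eq_bigr => t _.
rewrite !linearZ /= !tmap_tens; congr (_ *: tens _).
by apply/funext => i; rewrite comp_lfunE.
Qed.

Lemma sum_group (V : nmodType) (F : 'End(W) -> V) h : h \in G ->
  \sum_(g <- G) F (h \o g)%VF = \sum_(g <- G) F g.
Proof.
have [_ GM GV] := Gsub => hG; rewrite -(big_map (comp_lfun h) xpredT F).
apply/perm_big/uniq_perm; rewrite ?fset_uniq ?map_inj_uniq ?fset_uniq //.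
  move=> g g' e; have [/eqP h0 _] := GV h hG.
  by rewrite -(lker0_compKf h0 g) e (lker0_compKf h0).
move=> g; apply/mapP/idP => [[g' g'G ->]|gG]; first exact: GM.
have [/eqP h0 hVG] := GV h hG; exists (h^-1 \o g)%VF; first exact: GM.
by rewrite comp_lfunA lker0_compfV // comp_lfun1l.
Qed.

Definition orbit_sum n (x : tpow W n) : tpow W n := \sum_(g <- G) tmap g x.

Lemma orbit_sum_inv n (x : tpow W n) : orbit_sum x \in tinv G n.
Proof.
apply/tinvP => h hG; rewrite linear_sum /= -[RHS](sum_group _ hG).
by apply: eq_bigr => g _; rewrite tmapM.
Qed.

Lemma orbit_sum_linear n : linear (@orbit_sum n).
Proof.
move=> c x y; rewrite /orbit_sum scaler_sumr -big_split; apply: eq_bigr => g _.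
exact: tmap_linear.
Qed.

Hypothesis Gk : (#|` G|)%:R != 0 :> k.

Definition reynolds n (x : tpow W n) : inv_obj G n :=
  Subvs (memvZ ((#|` G|)%:R^-1) (orbit_sum_inv x)).

Lemma reynolds_linear n : linear (@reynolds n).
Proof.
move=> c x y; apply: val_inj; rewrite /= orbit_sum_linear scalerDr.
by rewrite !scalerA mulrC.
Qed.

HB.instance Definition _ n :=
  GRing.isLinear.Build k (tpow W n) (inv_obj G n) _ (@reynolds n) (@reynolds_linear n).

Lemma reynolds_id n (x : inv_obj G n) : reynolds (vsval x) = x.
Proof.
apply: val_inj => /=; rewrite /orbit_sum (eq_big_seq (fun=> vsval x)) => [|g gG].
  by rewrite big_const_seq count_predT iter_addr_0 -scaler_nat scalerA mulVf // scale1r.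
exact: (tinvP _ _ (subvsP x)).
Qed.

Lemma reynolds_act n s (x : tpow W n) : reynolds (tact s x) = inv_act s (reynolds x).
Proof.
have tactZ c (y : tpow W n) : tact s (c *: y) = c *: tact s y.
  by apply/ffunP => t; rewrite !ffunE.
have tact_sum (F : 'End(W) -> tpow W n) : tact s (\sum_(g <- G) F g) = \sum_(g <- G) tact s (F g).
  by apply/ffunP => t; rewrite ffunE !sum_ffunE; apply: eq_bigr => g _; rewrite ffunE.
apply: val_inj; rewrite /= tactZ tact_sum; congr (_ *: _).
by apply: eq_bigr => g _; rewrite tmap_tact.
Qed.

Lemma reynolds_mulr m n (x : tpow W m) (y : inv_obj G n) :
  reynolds (tmul x (vsval y)) = inv_mul (reynolds x) y.
Proof.
apply: val_inj; apply/ffunP => t; rewrite /= !ffunE !sum_ffunE /= /GRing.scale /=.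
rewrite -mulrA mulr_suml; congr (_ * _); apply: eq_big_seq => g gG.
by rewrite tmap_tmul (tinvP _ _ (subvsP y)) // [LHS]ffunE.
Qed.

Lemma reynolds_mull m n (x : inv_obj G m) (y : tpow W n) :
  reynolds (tmul (vsval x) y) = inv_mul x (reynolds y).
Proof.
apply: val_inj; apply/ffunP => t; rewrite /= !ffunE !sum_ffunE /= /GRing.scale /=.
rewrite [RHS]mulrCA [in RHS]mulr_sumr; congr (_ * _); apply: eq_big_seq => g gG.
by rewrite tmap_tmul (tinvP _ _ (subvsP x)) // [LHS]ffunE.
Qed.

Lemma reynolds_gcast m n (E : m = n) (x : tpow W m) :
  reynolds (gcast (V := @tobj k W) E x) = gcast (V := inv_obj G) E (reynolds x).
Proof. by case: n / E. Qed.

End Reynolds.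

Section Generation.
Local Open Scope ring_scope.
Variables (k : fieldType) (W : vectType k) (G : {fset 'End(W)}).
Hypothesis Gsub : finite_subgroup_GL G.
Hypothesis Gk : (#|` G|)%:R != 0 :> k.

Lemma tens_split l m n (E : (l + m)%N = n) (s : 'S_n) (z : 'I_n -> W) :
  tens z = tact s (gcast (V := @tobj k W) E
    (tmul (tens (fun a => z (s (cast_ord E (lshift m a)))))
          (tens (fun b => z (s (cast_ord E (rshift l b))))))).
Proof.
case: n / E s z => s z /=; rewrite tmul_tens tact_tens; congr tens.
apply/funext => i; rewrite -{1}(permKV s i); case: splitP => a e; congr (z (s _));
  by apply: val_inj; rewrite /= e.
Qed.

Lemma tens_add n (u v : 'I_n -> W) :
  tens (fun i => u i + v i) =
  \sum_(S : {set 'I_n}) tens (fun i => if i \in S then u i else v i).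
Proof.
apply/ffunP => t; rewrite sum_ffunE ffunE.
under eq_bigr => i _ do rewrite linearD.
rewrite bigA_distr; apply: eq_bigr => S _; rewrite ffunE.
by apply: eq_bigr => i _; case: ifP.
Qed.

Lemma tens0 n (u : 'I_n -> W) i : u i = 0 -> tens u = 0.
Proof.
by move=> ui; apply/ffunP => t; rewrite !ffunE (bigD1 i) //= ui linear0 mul0r.
Qed.

Local Notation R := (invariant_tca G).

Lemma subtca_gcast (P : gsubset R) m n (E : m = n) (x : R m) : P m x -> P n (gcast E x).
Proof. by case: n / E. Qed.

Lemma orbit_sum_block n (S : {set 'I_n}) (u w : 'I_n -> W) :
  exists m (E : (#|S| + m)%N = n) (s : 'S_n) (u' : 'I_#|S| -> W) (w' : 'I_m -> W),
    \sum_(h <- G) tens (fun i => if i \in S then h (u i) else w i) =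
    tact s (gcast (V := @tobj k W) E (tmul (orbit_sum G (tens u')) (tens w'))).
Proof.
have [l [E [s sE]]] := @extend_inj _ _ (fun b : 'I_#|~: S| => enum_val b) (@enum_val_inj _ _).
have lS : l = #|S| by apply: (@addIn #|~: S|); rewrite E cardsC card_ord.
subst l; exists #|~: S|, E, s, (fun a => u (s (cast_ord E (lshift _ a)))),
  (fun b => w (s (cast_ord E (rshift _ b)))).
have inS a : s (cast_ord E (lshift _ a)) \in S.
  apply: contraT; rewrite -finset.in_setC => h.
  have := sE (enum_rank_in h (s (cast_ord E (lshift _ a)))); rewrite enum_rankK_in //.
  by move/perm_inj/cast_ord_inj/eqP; rewrite eq_shift.
have notS b : s (cast_ord E (rshift _ b)) \in S = false.
  by apply/negbTE; rewrite sE -finset.in_setC; exact: enum_valP.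
have tact_sum (F : 'End(W) -> tpow W n) : tact s (\sum_(g <- G) F g) = \sum_(g <- G) tact s (F g).
  by apply/ffunP => t; rewrite ffunE !sum_ffunE; apply: eq_bigr => g _; rewrite ffunE.
transitivity (tact s (\sum_(h <- G) gcast (V := @tobj k W) E (tmul
    (tmap h (tens (fun a => u (s (cast_ord E (lshift _ a))))))
    (tens (fun b => w (s (cast_ord E (rshift _ b)))))))); last first.
  congr tact; apply/ffunP => t; rewrite gcast_tpow !ffunE !sum_ffunE mulr_suml.
  by apply: eq_bigr => h _; rewrite gcast_tpow [LHS]ffunE; congr (_ * _); rewrite ffunE.
rewrite tact_sum; apply: eq_bigr => h _; rewrite [LHS](tens_split E s) tmap_tens.
under [in LHS]eq_fun => a do rewrite inS.
by under [X in tmul _ (tens X)]eq_fun => b do rewrite notS.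
Qed.

(* Each [h : G] is inverse to some [g_i], so [\prod_i (w_i - h (g_i w_i))]
   vanishes; summing its expansion over [h] isolates [#|G|] times [tens w]. *)
Lemma fogarty n (w : 'I_n -> W) : (#|` G| <= n)%N ->
  exists u : 'I_n -> W, (forall i : 'I_n, (#|` G| <= i)%N -> u i = 0) /\
    (#|` G|)%:R *: tens w =
    - \sum_(S : {set 'I_n} | S != finset.set0)
        \sum_(h <- G) tens (fun i => if i \in S then h (u i) else w i).
Proof.
move=> leGn; pose u (i : 'I_n) := if (i < #|` G|)%N then - (nth \1%VF G i (w i)) else 0.
exists u; split=> [i|]; first by rewrite /u leqNgt => /negbTE ->.
apply/eqP; rewrite -addr_eq0; apply/eqP.
transitivity (\sum_(h <- G) tens (fun i => h (u i) + w i)); last first.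
  rewrite big1_seq // => h /andP[_ hG].
  have [_ _ /(_ h hG)[/eqP h0 hV]] := Gsub.
  have lt_i : (index (h^-1)%VF G < #|` G|)%N by rewrite index_mem.
  apply: (@tens0 _ _ (Ordinal (leq_trans lt_i leGn))).
  by rewrite /u /= lt_i nth_index // linearN /= lker0_lfunVK ?addNr.
under [RHS]eq_bigr => h _ do rewrite tens_add.
rewrite [RHS]exchange_big /= [RHS](bigD1 finset.set0) //=; congr (_ + _).
transitivity (\sum_(h <- G) tens w).
  by rewrite big_const_seq count_predT iter_addr_0 scaler_nat.
by apply: eq_bigr => h _; congr tens; apply/funext => i; rewrite finset.in_set0.
Qed.

Lemma generated_in_degree_le : tca_generated_in_degree_le R #|` G|.
Proof.
exists (fun h => (tag h <= #|` G|)%N); split=> // P [[P0 Plin Pact] P1 Pmul] Pgen n.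
have [r] := ubnP n; elim: r n => // r IH n; rewrite ltnS => le_nr x.
have [le_n|/ltnW le_Gn] := leqP n #|` G|; first exact: (Pgen (existT _ n x)).
have Psum (I : Type) (s : seq I) (Q : pred I) (F : I -> inv_obj G n) :
    (forall i, Q i -> P n (F i)) -> P n (\sum_(i <- s | Q i) F i).
  move=> PF; apply: (big_ind (P n)) => // y z Py Pz.
  by rewrite -[y]scale1r; apply: Plin.
have PZ c y : P n y -> P n (c *: y).
  by move=> Py; rewrite -[_ *: _]addr0; apply: Plin.
suff Ptens w : P n (reynolds Gsub (tens w)).
  rewrite -(reynolds_id Gsub Gk x) [vsval x]tens_decomp linear_sum /=.
  by apply: Psum => t _; rewrite linearZ; apply/PZ/Ptens.
have [u [u0 /(congr1 ( *:%R (#|` G|)%:R^-1))]] := fogarty w le_Gn.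
rewrite scalerA mulVf // scale1r => ->; rewrite linearZ linearN /= -scaleN1r.
apply: (PZ); apply: (PZ); rewrite linear_sum /=; apply: Psum => S S0.
have [le_SG|lt_GS] := leqP #|S| #|` G|; last first.
  rewrite big1 ?linear0 => [|h _]; first exact: P0.
  have [i iS le_Gi] : exists2 i, i \in S & (#|` G| <= i)%N.
    apply/exists_inP; apply: contraLR lt_GS; rewrite negb_exists_in -leqNgt => /forall_inP S_lt.
    rewrite cardE -(size_map val) -[leqRHS](size_iota 0); apply: uniq_leq_size.
      by rewrite map_inj_uniq ?enum_uniq //; exact: val_inj.
    move=> _ /mapP[i + ->]; rewrite mem_enum mem_iota => /S_lt; rewrite add0n.
    by rewrite -ltnNge.
  by apply: (tens0 (i := i)); rewrite iS u0 // linear0.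
have [m [E [s [u' [w' ->]]]]] := orbit_sum_block S u w.
rewrite reynolds_act; apply: Pact; rewrite reynolds_gcast; apply: subtca_gcast.
rewrite (reynolds_mull Gsub (Subvs (orbit_sum_inv Gsub (tens u')))).
apply: Pmul; first exact: (Pgen (existT _ _ _)).
apply: IH; apply: leq_trans le_nr; rewrite -E -[ltnLHS]add0n ltn_add2r card_gt0.
by [].
Qed.
End Generation.

(** * Noetherianity *)

(* [inr None] is only the default value of [nth]. *)
Section Layouts.
Variables (I L : Type).
Local Notation J := (I + option L)%type.

(* The layout [g] says which positions of a word of length [N] carry a prescribed
   letter and which ones are filled from a word [s] of length [n]. *)
Definition layout_word n N (g : 'I_N -> I + 'I_n) (s : seq J) : seq J :=
  [seq match g j with inl c => inl c | inr b => nth (inr None) s b end | j <- enum 'I_N].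

Definition comp_layout n m N (g : 'I_N -> I + 'I_n) (h : 'I_n -> I + 'I_m) (j : 'I_N) :=
  match g j with inl c => inl c | inr b => h b end.

Definition layout n N (g : 'I_N -> I + 'I_n) :=
  exists f : 'I_n -> 'I_N, forall j b, g j = inr b <-> j = f b.

Definition block_layout l n N (E : (l + n)%N = N) (s : 'S_N) (w : {ffun 'I_l -> I}) (j : 'I_N) :
    I + 'I_n :=
  match split (cast_ord (esym E) ((s^-1)%g j)) with inl a => inl (w a) | inr b => inr b end.

Definition ins_layout n (p : 'I_n.+1) (c : I) (j : 'I_n.+1) : I + 'I_n :=
  if unlift p j is Some b then inr b else inl c.

Lemma size_layout_word n N (g : 'I_N -> I + 'I_n) s : size (layout_word g s) = N.
Proof. by rewrite size_map size_enum_ord. Qed.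

Lemma nth_layout_word n N (g : 'I_N -> I + 'I_n) s (j : 'I_N) x0 :
  nth x0 (layout_word g s) j = match g j with inl c => inl c | inr b => nth (inr None) s b end.
Proof. by rewrite (nth_map j) ?size_enum_ord // nth_ord_enum. Qed.

Lemma layout_word_comp n m N (g : 'I_N -> I + 'I_n) (h : 'I_n -> I + 'I_m) s :
  layout_word g (layout_word h s) = layout_word (comp_layout g h) s.
Proof.
apply: eq_map => j; rewrite /comp_layout; case: (g j) => // b.
by rewrite nth_layout_word.
Qed.

Lemma eq_layout_word n N (g h : 'I_N -> I + 'I_n) s : g =1 h -> layout_word g s = layout_word h s.
Proof. by move=> gh; apply: eq_map => j; rewrite gh. Qed.

Lemma layout_word_ins n (p : 'I_n.+1) c s : size s = n ->
  layout_word (ins_layout p c) s = take p s ++ inl c :: drop p s.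
Proof.
move=> sn; apply: (@eq_from_nth _ (inr None)) => [|j].
  by rewrite size_layout_word size_cat /= addnS -size_cat cat_take_drop sn.
rewrite size_layout_word => lt_j; rewrite (nth_layout_word _ _ (Ordinal lt_j)) /ins_layout nth_cat.
have sp : size (take p s) = p by rewrite size_takel // sn -ltnS.
rewrite sp; case: unliftP => [b|] ej.
  have -> : j = bump p b by have := congr1 val ej.
  rewrite /bump; case: (leqP p b) => pb.
    by rewrite ltnNge (leq_trans pb) //= addnC addn1 subSn //= nth_drop subnKC.
  by rewrite add0n pb nth_take.
by have -> : j = p by [have := congr1 val ej]; rewrite ltnn subnn.
Qed.

Lemma layout_comp n m N (g : 'I_N -> I + 'I_n) (h : 'I_n -> I + 'I_m) :
  layout g -> layout h -> layout (comp_layout g h).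
Proof.
move=> [f gf] [f' hf']; exists (f \o f') => j b; rewrite /comp_layout /=; split.
  by case gj: (g j) => [//|b'] /hf' eb; apply/gf; rewrite gj eb.
by move/gf => ->; apply/hf'.
Qed.

Lemma layout_ins n (p : 'I_n.+1) c : layout (ins_layout p c).
Proof.
exists (lift p) => j b; rewrite /ins_layout; split; last by move=> ->; rewrite liftK.
by case: unliftP => [b' -> [->]|].
Qed.

Lemma block_layoutE l n N (E : (l + n)%N = N) (s : 'S_N) (w : {ffun 'I_l -> I}) j :
  block_layout E s w (s (cast_ord E j)) =
    match split j with inl a => inl (w a) | inr b => inr b end.
Proof. by rewrite /block_layout permK cast_ordK. Qed.

Lemma layoutP n N (g : 'I_N -> I + 'I_n) : layout g ->
  exists l (E : (l + n)%N = N) (s : 'S_N) (w : {ffun 'I_l -> I}), g =1 block_layout E s w.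
Proof.
move=> [f gf]; have f_inj : injective f.
  by move=> b b' /(gf _ b').2; rewrite ((gf _ b).2 (erefl _)) => -[].
have [l [E [s sE]]] := extend_inj f_inj.
have /fin_all_exists[w wP] (a : 'I_l) : exists c, g (s (cast_ord E (lshift n a))) = inl c.
  case ga: (g _) => [c|b]; first by exists c.
  move/gf: ga; rewrite -sE => /perm_inj/cast_ord_inj/eqP.
  by rewrite eq_shift.
exists l, E, s, (finfun w) => j.
rewrite -(permKV s j) -(cast_ordKV E ((s^-1)%g j)) block_layoutE.
case: split_ordP => a ->; first by rewrite ffunE wP.
by apply/gf; rewrite sE.
Qed.
End Layouts.

Section FormalSums.
Local Open Scope ring_scope.
Variables (k : fieldType) (K J : finType) (V : lmodType k).

Definition lin_ext (f : K * seq J -> V) (x : seq (k * (K * seq J))) : V :=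
  \sum_(z <- x) z.1 *: f z.2.

Lemma lin_ext_coef f x (s : seq (K * seq J)) : uniq s -> {subset [seq z.2 | z <- x] <= s} ->
  lin_ext f x = \sum_(b <- s) coef x b *: f b.
Proof.
move=> us xs; rewrite /lin_ext; under [RHS]eq_bigr => b _ do rewrite scaler_suml big_mkcond.
rewrite exchange_big /=; apply: eq_big_seq => z zx.
rewrite (bigD1_seq z.2) ?xs ?map_f //= eqxx big1 ?addr0 // => b.
by rewrite eq_sym => /negbTE ->.
Qed.

Lemma eq_coef_lin_ext f x y : coef x =1 coef y -> lin_ext f x = lin_ext f y.
Proof.
move=> xy; pose s := undup ([seq z.2 | z <- x] ++ [seq z.2 | z <- y]).
rewrite !(@lin_ext_coef _ _ s) ?undup_uniq //; first by apply: eq_bigr => b _; rewrite xy.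
  by move=> b h; rewrite mem_undup mem_cat h orbT.
by move=> b h; rewrite mem_undup mem_cat h.
Qed.

Lemma lin_ext_lin f a x y : lin_ext f (scal a x ++ y) = a *: lin_ext f x + lin_ext f y.
Proof.
rewrite /lin_ext big_cat big_map scaler_sumr; congr (_ + _).
by apply: eq_bigr => z _; rewrite scalerA.
Qed.

Lemma lin_ext_cat f x y : lin_ext f (x ++ y) = lin_ext f x + lin_ext f y.
Proof. by rewrite /lin_ext big_cat. Qed.

Lemma lin_ext_mapb f h x : lin_ext f (mapb h x) = lin_ext (f \o h) x.
Proof. by rewrite /lin_ext big_map. Qed.
End FormalSums.

Section Noetherian.
Local Open Scope ring_scope.
Variables (k : fieldType) (W : vectType k) (G : {fset 'End(W)}).
Hypothesis Gsub : finite_subgroup_GL G.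
Hypothesis Gk : (#|` G|)%:R != 0 :> k.
Local Notation R := (invariant_tca G).
Local Notation I := 'I_(\dim {:W}).
Variables (M : tca_module R) (r : nat) (gen : 'I_r -> helt M).
Local Notation d i := (tag (gen i)).
Local Notation L := {i : 'I_r & 'I_(d i)}.
Local Notation J := (I + option L)%type.
Local Notation B := ('I_r * seq J)%type.

Definition isI (c : J) := if c is inl _ then true else false.

Section LinearPredicate.
Variables (U V : lmodType k) (f : U -> V).
Hypothesis f_lin : linear f.

Lemma linear_pred0 : f 0 = 0.
Proof. by have := f_lin 1 0 0; rewrite !scale1r addr0 -[LHS]addr0 => /addrI. Qed.

Lemma linear_predD x y : f (x + y) = f x + f y.
Proof. by rewrite -[x]scale1r f_lin !scale1r. Qed.

Lemma linear_predZ c x : f (c *: x) = c *: f x.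
Proof. by rewrite -[c *: x]addr0 f_lin linear_pred0 addr0. Qed.

Lemma linear_pred_sum (T : Type) (s : seq T) (c : T -> k) (x : T -> U) :
  f (\sum_(t <- s) c t *: x t) = \sum_(t <- s) c t *: f (x t).
Proof.
by elim: s => [|t s IH]; rewrite ?big_nil ?linear_pred0 // !big_cons f_lin IH.
Qed.
End LinearPredicate.

Definition basis_tensor n (v : {ffun 'I_n -> I}) : tpow W n :=
  tens (fun i => (vbasis {:W})`_(v i)).

(* [block_act E s a y] places the letters of [a] at the first [l] positions of the
   layout [(E, s)] and those of [y] at the remaining ones. *)
Definition block_act l n N (E : (l + n)%N = N) (s : 'S_N) (a : R l) (y : M n) : M N :=
  srep_act s (gcast E (mod_act a y)).

Lemma block_act_linearl l n N (E : (l + n)%N = N) (s : 'S_N) (y : M n) :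
  linear (fun a : R l => block_act E s a y).
Proof.
move=> c a b; rewrite /block_act (mod_act_linearl y c a b).
by case: N / E s => s; rewrite srep_act_linear.
Qed.

Lemma block_act_linearr l n N (E : (l + n)%N = N) (s : 'S_N) (a : R l) :
  linear (block_act E s a : M n -> M N).
Proof.
move=> c x y; rewrite /block_act (mod_act_linearr a c x y).
by case: N / E s => s; rewrite srep_act_linear.
Qed.

Lemma block_act_comp l m n N n' (E : (l + n)%N = N) (s : 'S_N) (E' : (m + n')%N = n) (t : 'S_n) :
  exists (E'' : (l + m + n')%N = N) (u : 'S_N),
    (forall (a : R l) (b : R m) (y : M n'),
      block_act E s a (block_act E' t b y) = block_act E'' u (inv_mul a b) y) /\
    forall (T : Type) (v : {ffun 'I_l -> T}) (w : {ffun 'I_m -> T}),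
      comp_layout (block_layout E s v) (block_layout E' t w) =1
      block_layout E'' u [ffun i => match split i with inl a => v a | inr b => w b end].
Proof.
subst n N; exists (esym (addnA l m n')), (osum 1 t * s)%g; split.
  move=> a b y; rewrite /block_act /= srep_actM; congr srep_act.
  rewrite -{1}[a](srep_act1 a) mod_act_equiv; congr srep_act.
  by rewrite -[inv_mul a b]/(tca_mul a b) -mod_actA; case: _ / (addnA l m n') (mod_act _ _).
move=> T v w j; rewrite /comp_layout.
set E := esym _; set u := (_ * _)%g.
have layr l' n (s' : 'S_(l' + n)) (w' : {ffun 'I_l' -> T}) i :
    block_layout (n := n) (erefl _) s' w' (s' i) =
    match split i with inl a => inl (w' a) | inr b => inr b end.
  by have := block_layoutE (n := n) (erefl _) s' w' i; rewrite cast_ord_id.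
rewrite -(permKV u j) -(cast_ordKV E ((u^-1)%g j)) block_layoutE.
case: split_ordP => [i|d] ->; rewrite permM.
  rewrite ffunE; case: (split_ordP i) => [a|c] ->.
    have -> : cast_ord E (lshift n' (lshift m a)) = lshift (m + n') a by apply: val_inj.
    by rewrite osum_lshift perm1 layr (unsplitK (inl a)).
  have -> : cast_ord E (lshift n' (rshift l c)) = rshift l (lshift n' c) by apply: val_inj.
  by rewrite osum_rshift layr (unsplitK (inr _)) layr (unsplitK (inl c)).
have -> : cast_ord E (rshift (l + m) d) = rshift l (rshift m d).
  by apply: val_inj; rewrite /= addnA.
by rewrite osum_rshift layr (unsplitK (inr _)) layr (unsplitK (inr d)).
Qed.

Lemma block_act_layout_eq l l' n N (E : (l + n)%N = N) (E' : (l' + n)%N = N) (s s' : 'S_N)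
    (v : {ffun 'I_l -> I}) (v' : {ffun 'I_l' -> I}) (y : M n) :
  block_layout (n := n) E s v =1 block_layout E' s' v' ->
  block_act E s (reynolds Gsub (basis_tensor v)) y =
    block_act E' s' (reynolds Gsub (basis_tensor v')) y.
Proof.
move=> e; have ll : l' = l by apply: (@addIn n); rewrite E E'.
subst l' N; rewrite (eq_irrelevance E' (erefl _)) in e *.
pose p := (s * s'^-1)%g.
have pE j : match split (p j) with inl a => inl (v' a) | inr b => inr b end =
    match split j with inl a => inl (v a) | inr b => inr b end :> I + 'I_n.
  have := e (s j); have := block_layoutE (n := n) (erefl _) s v j; rewrite cast_ord_id => -> ->.
  have := block_layoutE (n := n) (erefl _) s' v' (p j); rewrite cast_ord_id permM permKV => ->.
  by [].
have pr b : p (rshift l b) = rshift l b.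
  by move: (pE (rshift l b)); rewrite (unsplitK (inr b)); case: split_ordP => // b' -> [->].
have pl a : exists a', p (lshift n a) = lshift n a' /\ v' a' = v a.
  move: (pE (lshift n a)); rewrite (unsplitK (inl a)).
  by case: split_ordP => // a' -> [ea]; exists a'.
have {pl} /fin_all_exists[q qP] := pl.
have q_inj : injective q.
  move=> a b ab; have := (qP a).1; rewrite ab -(qP b).1 => /perm_inj/eqP.
  by rewrite eq_shift => /eqP.
have -> : s = (osum (perm q_inj) 1 * s')%g.
  rewrite -[s](mulgKV s') -/p; congr (_ * _)%g; apply/permP => j.
  rewrite -(splitK j); case: (split j) => a /=.
    by rewrite osum_lshift (permE q_inj) (qP a).1.
  by rewrite osum_rshift perm1 pr.
rewrite /block_act /= srep_actM; congr srep_act.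
rewrite -(mod_act_equiv (perm q_inj) 1) srep_act1; congr mod_act.
rewrite -[srep_act _ _]reynolds_act; congr reynolds.
rewrite /basis_tensor tact_tens; congr tens; apply/funext => j.
by rewrite -[in RHS](permKV (perm q_inj) j) (permE q_inj) (qP _).2.
Qed.

Definition labels i : seq J := [seq inr (Some (Tagged (fun i => 'I_(d i)) b)) | b <- enum 'I_(d i)].

Lemma nth_labels i (b : 'I_(d i)) : nth (inr None) (labels i) b = inr (Some (Tagged _ b)).
Proof. by rewrite (nth_map b) ?size_enum_ord // nth_ord_enum. Qed.

Lemma layout_word_labels_inj i N (g h : 'I_N -> I + 'I_(d i)) :
  layout_word g (labels i) = layout_word h (labels i) -> g =1 h.
Proof.
move=> e j; have := congr1 (fun s => nth (inr None) s j) e; rewrite !nth_layout_word.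
case: (g j) (h j) => [c|b] [c'|b']; rewrite ?nth_labels //; first by move=> [->].
by move=> [] /eqP; rewrite eq_Tagged /= => /eqP ->.
Qed.

Lemma word_value_exists N (b : B) : exists y : M N,
  forall m (E : (m + d b.1)%N = N) (s : 'S_N) (v : {ffun 'I_m -> I}),
    b.2 = layout_word (block_layout E s v) (labels b.1) ->
    y = block_act E s (reynolds Gsub (basis_tensor v)) (tagged (gen b.1)).
Proof.
have [[m [E [s [v e]]]]|h] := pselect (exists m (E : (m + d b.1)%N = N) (s : 'S_N)
    (v : {ffun 'I_m -> I}), b.2 = layout_word (block_layout E s v) (labels b.1)).
  exists (block_act E s (reynolds Gsub (basis_tensor v)) (tagged (gen b.1))) => m' E' s' v'.
  by rewrite e => /layout_word_labels_inj; apply: block_act_layout_eq.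
by exists 0 => m E s v e; case: h; exists m, E, s, v.
Qed.

Definition word_value N (b : B) : M N := sval (cid (word_value_exists N b)).

Lemma word_valueE i m N (E : (m + d i)%N = N) (s : 'S_N) (v : {ffun 'I_m -> I}) :
  word_value N (i, layout_word (block_layout E s v) (labels i)) =
  block_act E s (reynolds Gsub (basis_tensor v)) (tagged (gen i)).
Proof. exact: (svalP (cid (word_value_exists N (i, _)))). Qed.

Definition lift_term i m n (E : (m + d i)%N = n) (s : 'S_n) (a : R m) : seq (k * B) :=
  [seq ((vsval a : tpow W m) v, (i, layout_word (block_layout E s v) (labels i)))
  | v <- enum {ffun 'I_m -> I}].

Inductive lifts n : seq (k * B) -> M n -> Prop :=
| lifts0 : lifts [::] 0
| liftsS i m (E : (m + d i)%N = n) (s : 'S_n) (a : R m) x y :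
    lifts x y -> lifts (lift_term E s a ++ x) (block_act E s a (tagged (gen i)) + y).

Lemma lifts_map n n' (f : M n -> M n') : linear f ->
  (forall i m (E : (m + d i)%N = n) (s : 'S_n) (a : R m), exists m' (E' : (m' + d i)%N = n') s' a',
    f (block_act E s a (tagged (gen i))) = block_act E' s' a' (tagged (gen i))) ->
  forall x y, lifts x y -> exists x', lifts x' (f y).
Proof.
move=> lf fE x y; elim=> {x y} [|i m E s a x y _ [x' xy']].
  by exists [::]; rewrite (linear_pred0 lf); constructor.
have [m' [E' [s' [a' e]]]] := fE i m E s a.
exists (lift_term E' s' a' ++ x'); rewrite (linear_predD lf) e.
exact: liftsS.
Qed.

Lemma lifts_add n x y x' y' : lifts (n := n) x y -> lifts x' y' -> lifts (x ++ x') (y + y').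
Proof.
move=> xy xy'; elim: xy => {x y} [|i m E s a x y _ IH]; first by rewrite add0r.
by rewrite -catA -addrA; apply: liftsS.
Qed.

Hypothesis gen_generates : forall N : gsubset M, is_submodule N ->
  (forall i, N (d i) (tagged (gen i))) -> forall n y, N n y.

Lemma lifts_surj n (y : M n) : exists x, lifts x y.
Proof.
move: n y; apply: gen_generates => [|i]; last first.
  exists (lift_term (add0n (d i)) 1 (tca_one R) ++ [::]).
  have e : tagged (gen i) = block_act (add0n (d i)) 1 (tca_one R) (tagged (gen i)) + 0.
    by rewrite addr0 /block_act mod_act1 srep_act1.
  by rewrite [X in lifts _ X]e; apply: liftsS; constructor.
split; first split.
- by move=> n; exists [::]; constructor.
- move=> n c y z [x xy] [x' xz].
  suff [x'' xy''] : exists x'', lifts x'' (c *: y) by exists (x'' ++ x'); apply: lifts_add.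
  apply: lifts_map xy => [b u v|i m E s a]; first by rewrite scalerDr !scalerA mulrC.
  by exists m, E, s, (c *: a); rewrite (linear_predZ (block_act_linearl _ _ _)).
- move=> n s y [x xy]; apply: lifts_map xy; first exact: srep_act_linear.
  by move=> i m E t a; exists m, E, (t * s)%g, a; rewrite /block_act srep_actM.
move=> m n a y [x xy]; apply: lifts_map xy; first exact: mod_act_linearr.
move=> i l E s b; have [E'' [u [e _]]] := block_act_comp (erefl (m + n)%N) 1 E s.
by exists (m + l)%N, E'', u, (inv_mul a b); rewrite -e /block_act srep_act1.
Qed.

Definition value N := lin_ext (word_value N).

Definition layout_wordb n N (g : 'I_N -> I + 'I_n) (b : B) : B := (b.1, layout_word g b.2).

Lemma tensor_basis_decomp n (x : tpow W n) :
  x = \sum_(v <- enum {ffun 'I_n -> I}) x v *: basis_tensor v.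
Proof. by rewrite big_enum; exact: tens_decomp. Qed.

Lemma value_lifts n x (y : M n) : lifts x y -> value n x = y.
Proof.
elim=> {x y} [|i m E s a x y _ IH]; first by rewrite /value /lin_ext big_nil.
rewrite /value lin_ext_cat -/(value n x) IH; congr (_ + _).
rewrite /lin_ext big_map /= -[in RHS](reynolds_id Gsub Gk a).
rewrite [in RHS](tensor_basis_decomp (vsval a)).
rewrite (linear_pred_sum (@reynolds_linear _ _ _ Gsub m)).
rewrite (linear_pred_sum (block_act_linearl E s (tagged (gen i)))).
by apply: eq_bigr => v _; rewrite word_valueE.
Qed.

Lemma value_layout_lifts l n N (E : (l + n)%N = N) (s : 'S_N) (w : {ffun 'I_l -> I}) x (y : M n) :
  lifts x y ->
  value N (mapb (layout_wordb (block_layout E s w)) x) =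
    block_act E s (reynolds Gsub (basis_tensor w)) y.
Proof.
elim=> {x y} [|i m E' t a x y _ IH].
  by rewrite (linear_pred0 (block_act_linearr _ _ _)) /value /lin_ext big_nil.
rewrite /mapb map_cat /value lin_ext_cat -/(mapb _ x) -/(value N (mapb _ x)) IH.
rewrite (linear_predD (block_act_linearr _ _ _)); congr (_ + _).
have [E'' [u [block_actE layE']]] := block_act_comp E s E' t.
rewrite block_actE -reynolds_mulr /lin_ext big_map big_map.
rewrite [in RHS](tensor_basis_decomp (vsval a)).
rewrite (linear_pred_sum (tmul_linearr (basis_tensor w))).
rewrite (linear_pred_sum (@reynolds_linear _ _ _ Gsub _)).
rewrite (linear_pred_sum (block_act_linearl E'' u (tagged (gen i)))).
apply: eq_bigr => v _; rewrite /layout_wordb layout_word_comp (eq_layout_word _ (layE' _ _ _)) word_valueE.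
congr (_ *: block_act _ _ (reynolds _ _) _).
rewrite /basis_tensor tmul_tens; congr tens; apply/funext => j.
by rewrite ffunE; case: split.
Qed.

Lemma count_labels i m n (E : (m + d i)%N = n) (s : 'S_n) (v : {ffun 'I_m -> I}) :
  count (predC isI) (layout_word (block_layout E s v) (labels i)) = d i.
Proof.
subst n; rewrite count_map -sum1_count big_mkcond big_enum /=.
rewrite (reindex_inj (@perm_inj _ s)) big_split_ord /=.
have layE' j := block_layoutE (n := d i) (erefl (m + d i)%N) s v j.
rewrite big1 ?add0n => [|a _].
  rewrite -[RHS](card_ord (d i)) -sum1_card; apply: eq_bigr => b _.
  by have := layE' (rshift m b); rewrite cast_ord_id (unsplitK (inr b)) => ->; rewrite nth_labels.
by have := layE' (lshift (d i) a); rewrite cast_ord_id (unsplitK (inl a)) => ->.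
Qed.

Lemma lifts_homog n x (y : M n) : lifts x y -> homog isI (\max_i d i) n x.
Proof.
elim=> {x y} // i m E s a x y _ IH; rewrite /homog all_cat; apply/andP; split=> //.
apply/allP => _ /mapP[v _ ->] /=; rewrite size_layout_word eqxx count_labels.
exact: leq_bigmax.
Qed.

Lemma submodule_gen_submodule (S : set (helt M)) : is_submodule (submodule_gen S).
Proof.
split; first split.
- by move=> n N [[N0 _ _] _] _; apply: N0.
- move=> n c x y xS yS N NM SN; have [[_ Nlin _] _] := NM.
  by apply: Nlin; [exact: xS | exact: yS].
- by move=> n s x xS N NM SN; have [[_ _ Nact] _] := NM; apply: Nact; exact: xS.
by move=> m n a x xS N NM SN; have [_ Nmul] := NM; apply: Nmul; exact: xS.
Qed.

Lemma block_act_submodule (N : gsubset M) l n n' (E : (l + n)%N = n') (s : 'S_n') (a : R l) y :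
  is_submodule N -> N n y -> N n' (block_act E s a y).
Proof.
by move=> [[_ _ Nact] Nmul] Ny; apply: Nact; case: n' / E s => s; apply: Nmul.
Qed.

Lemma eq_coef_mapb (f : B -> B) N x y : coef x =1 coef y ->
  value N (mapb f x) = value N (mapb f y).
Proof. by move=> xy; rewrite /value !lin_ext_mapb; apply: eq_coef_lin_ext. Qed.

Lemma mapb_scal (f : B -> B) c (x y : seq (k * B)) :
  mapb f (scal c x ++ y) = scal c (mapb f x) ++ mapb f y.
Proof. by rewrite /mapb /scal map_cat -!map_comp. Qed.

Lemma ins_span_value (N0 : gsubset M) (P : nat -> seq (k * B) -> Prop) : is_submodule N0 ->
  (forall n x, P n x -> exists2 y : M n, N0 n y & lifts x y) ->
  forall n x, ins_span isI (\max_i d i) P n x -> N0 n (value n x) /\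
    forall n' (g : 'I_n' -> I + 'I_n), layout g -> N0 n' (value n' (mapb (layout_wordb g) x)).
Proof.
move=> NM PN; have [[N00 Nlin _] _] := NM.
have P_homog n x : P n x -> homog isI (\max_i d i) n x.
  by move=> /PN[y _ /lifts_homog].
have mapb_eq n n' (g h : 'I_n' -> I + 'I_n) (x : seq (k * B)) :
    g =1 h -> mapb (layout_wordb g) x =
  mapb (layout_wordb h) x.
  by move=> gh; apply: eq_map => z; rewrite /layout_wordb (eq_layout_word _ gh).
move=> n x; elim=> {n x}.
- move=> n x /PN[y Ny xy]; rewrite (value_lifts xy); split=> // n' g.
  move=> /layoutP[l [E [s [w e]]]]; rewrite (mapb_eq _ _ _ _ _ e) (value_layout_lifts _ _ _ xy).
  exact: block_act_submodule.
- by move=> n; rewrite /value /lin_ext big_nil; split=> // n' g _; rewrite big_nil.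
- move=> n c x y _ [Nx Nx'] _ [Ny Ny']; split=> [|n' g gl]; rewrite ?mapb_scal.
    by rewrite /value lin_ext_lin; apply: Nlin.
  by rewrite /value lin_ext_lin; apply: Nlin; [apply: Nx' | apply: Ny'].
- move=> n p [c|//] x pn _ /(ins_span_homog P_homog)/allP xn [_ Nx].
  have insE : mapb (insb p (inl c)) x =
    mapb (layout_wordb (ins_layout (Ordinal (pn : (p < n.+1)%N)) c)) x.
    apply/eq_in_map => z /xn/andP[/eqP zn _].
    by rewrite /layout_wordb layout_word_ins.
  rewrite insE; split=> [|n' g gl]; first by apply/Nx/layout_ins.
  rewrite /mapb -map_comp -/(mapb _ _).
  have -> : [seq ((fun z : k * B => (z.1, layout_wordb g z.2)) \o
     (fun z : k * B => (z.1, layout_wordb (ins_layout (Ordinal (pn : (p < n.+1)%N)) c) z.2))) i | i <- x] =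
     mapb (layout_wordb (comp_layout g (ins_layout (Ordinal (pn : (p < n.+1)%N)) c))) x.
    by apply: eq_map => z; rewrite /= /layout_wordb layout_word_comp.
  by apply/Nx/layout_comp => //; apply: layout_ins.
move=> n x y xy _ _ [Nx Nx']; split=> [|n' g gl].
  by rewrite /value -(eq_coef_lin_ext _ xy).
by rewrite -(eq_coef_mapb _ _ xy); apply: Nx'.
Qed.

Lemma submodule_finitely_generated (N : gsubset M) : is_submodule N -> submodule_fg N.
Proof.
move=> NM; pose P n (x : seq (k * B)) := exists2 y : M n, N n y & lifts x y.
have [|S SP Sspan] := @groebner k 'I_r J isI (\max_i d i) P.
  by move=> n x [y _ /lifts_homog].
have [T [Tfin TN ST]] : exists T : set (helt M), [/\ finite_set T,
    forall h, T h -> N (tag h) (tagged h) &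
    forall n x, mems S n x -> exists2 y : M n, T (existT _ n y) & lifts x y].
  elim: S SP {Sspan} => [|[n x] S IH] SP.
    by exists set0; split=> //; exact: finite_set0.
  have [z zS|T [Tfin TN ST]] := IH; first by apply: SP; rewrite inE zS orbT.
  have [y Ny xy] := SP (n, x) (mem_head _ _).
  exists ([set existT _ n y] `|` T)%classic; split.
  - by rewrite finite_setU; split=> //; exact: finite_set1.
  - by move=> h [->//|/TN].
  move=> n' x'; rewrite /mems inE => /orP[/eqP[-> ->]|/ST[y' Ty' xy']].
    by exists y => //; left.
  by exists y' => //; right.
exists T; split=> // n y; split=> [Ny|]; last by apply.
have [x xy] := lifts_surj y.
have TM := submodule_gen_submodule T.
have [] := ins_span_value TM _ (Sspan n x _); last by rewrite (value_lifts xy).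
  by move=> m z /ST[t Tt zt]; exists t => // N' _ /(_ _ Tt).
by exists y.
Qed.
End Noetherian.

Theorem invariant_tca_noetherian (k : fieldType) (W : vectType k) (G : {fset 'End(W)}) :
  finite_subgroup_GL G -> ((#|` G|)%:R != 0 :> k)%R -> tca_noetherian (invariant_tca G).
Proof.
move=> Gsub Gk M [S [Sfin Sgen]] N NM.
have /finite_seqP[s sE] : finite_set (S : set {n : nat & M n}) by [].
apply: (submodule_finitely_generated Gsub Gk (gen := fun i => tnth (in_tuple s) i)) NM.
move=> N' N'M N'gen n y; apply: (Sgen n y).1 => // h.
rewrite sE => /= /(nthP h)[i lt_i <-].
by have := N'gen (Ordinal lt_i); rewrite (tnth_nth h).
Qed.

(** * The modular case *)

Section Modular.
Local Open Scope ring_scope.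
Variables (k : fieldType) (W : vectType k) (G : {fset 'End(W)}).
Hypothesis Gsub : finite_subgroup_GL G.
Local Notation e := (vbasis {:W}).

Lemma finite_subgroup_GL_Cauchy p : prime p -> (p %| #|` G|)%N ->
  exists g, [/\ g \in G, g != \1%VF & forall w, iter p g w = w].
Proof.
move=> p_pr pG; have [G1 GM GV] := Gsub.
pose mul (g h : G) : G := FSetSub (GM _ _ (fsvalP g) (fsvalP h)).
have mul_inj g : injective (mul g).
  move=> h h' /(congr1 val) /= e; have [/eqP g0 _] := GV _ (fsvalP g).
  by apply: val_inj; rewrite /= -(lker0_compKf g0 (val h)) e (lker0_compKf g0).
pose lm g := perm (mul_inj g).
have lm_inj : injective lm.
  move=> g h /permP/(_ (FSetSub G1)); rewrite !permE => /(congr1 val) /=.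
  by rewrite !comp_lfun1r => /val_inj.
have lmG : group_set [set lm g | g : G].
  apply/group_setP; split.
    apply/imsetP; exists (FSetSub G1) => //; apply/permP => h; rewrite perm1 permE.
    by apply: val_inj; rewrite /= comp_lfun1l.
  move=> _ _ /imsetP[g _ ->] /imsetP[h _ ->]; apply/imsetP; exists (mul h g) => //.
  apply/permP => h'; rewrite permM !permE; apply: val_inj.
  by rewrite /= comp_lfunA.
have [x xG xp] : {x | x \in group lmG & #[x]%g = p}.
  by apply: Cauchy => //=; rewrite card_imset // -cardfE.
have /imsetP[g _ exg] := xG; exists (val g); split; first exact: fsvalP.
  apply: contraTneq p_pr => g1; rewrite -xp.
  suff -> : x = 1%g by rewrite order1.
  apply/permP => h; rewrite exg perm1 permE; apply: val_inj.
  by rewrite /= g1 comp_lfun1l.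
move=> w; have : (x ^+ p)%g (FSetSub G1) = FSetSub G1 by rewrite -xp expg_order perm1.
rewrite permX => /(congr1 (fun h : G => val h w)) /=; rewrite id_lfunE => {2}<-.
elim: p {pG xp p_pr} => [|n IH] /=; first by rewrite id_lfunE.
by rewrite IH exg permE /= comp_lfunE.
Qed.

Lemma unipotent_iter p (g : 'End(W)) : p \in [pchar k] -> (forall w, iter p g w = w) ->
  forall w, iter p (g - \1)%VF w = 0.
Proof.
move=> p_char gp w.
have [W0|Wpos] := posnP (dim W).
  move: (iter _ _ _) => v; apply: (can_inj (@VectorInternalTheory.v2rK _ W)).
  by apply/rowP => -[i lt_i]; exfalso; rewrite W0 in lt_i.
pose E := lfun_comp_nzRingType Wpos.
have expE (h : 'End(W)) n v : ((h : E) ^+ n : 'End(W)) v = iter n h v.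
  elim: n => [|n IH]; first by rewrite expr0 id_lfunE.
  by rewrite exprS [LHS]comp_lfunE IH.
have E_char : p \in [pchar E].
  rewrite inE (pcharf_prime p_char) /=.
  suff -> : p%:R = 0 :> E by [].
  apply/lfunP => v; rewrite zero_lfunE.
  transitivity (p%:R *: v); last by rewrite (pcharf0 p_char) scale0r.
  rewrite scaler_nat; elim: (p) => [|n IH]; first by rewrite zero_lfunE.
  by rewrite !mulrS [LHS]add_lfunE IH id_lfunE.
have gp1 : (g : E) ^+ p = 1 by apply/lfunP => v; rewrite expE gp id_lfunE.
rewrite -expE -[_ ^+ p]/(pFrobenius_aut E_char _).
rewrite (pFrobenius_autB_comm E_char (commr1 (g : E))) (pFrobenius_aut1 E_char).
by rewrite -[X in X - _]/((g : E) ^+ p) gp1 subrr zero_lfunE.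
Qed.

Lemma dual_jordan_pair (g : 'End(W)) p :
  p \in [pchar k] -> g != \1%VF -> (forall w, iter p g w = w) ->
  exists (l m : 'Hom(W, k^o)) (w : W), [/\ m w != 0, (l \o g)%VF = l + m & (m \o g)%VF = m].
Proof.
move=> p_char g1 gp; pose u := (g - \1)%VF.
pose Q j := `[< forall w, iter j u w = 0 >].
have exQ : exists j, Q j by exists p; apply/asboolP/unipotent_iter.
have iter_linear j : linear (iter j u).
  by elim: j => [|j IH] c x y //=; rewrite IH linearP.
pose U j : {linear W -> W} := HB.pack (iter j u) (GRing.isLinear.Build _ _ _ _ _ (iter_linear j)).
case: (ex_minnP exQ) => [[|[|j]] /asboolP Qj minQ].
- by case/eqP: g1; apply/lfunP => w; transitivity (0 : W); [|symmetry]; apply: Qj.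
- case/eqP: g1; apply/lfunP => w; apply/eqP; rewrite -subr_eq0.
  by rewrite -opp_lfunE -add_lfunE; apply/eqP/(Qj w).
have [w0 w0N] : exists w, iter j.+1 u w != 0.
  apply: contrapT => h; have /minQ : Q j.+1; last by rewrite ltnn.
  by apply/asboolP => w; apply: contrapT => /eqP hw; apply: h; exists w.
have [i ci] : exists i, coord e i (iter j.+1 u w0) != 0.
  apply/existsP; apply: contraNT w0N; rewrite negb_exists => /forallP h.
  rewrite (coord_vbasis (memvf (iter j.+1 u w0))) big1 // => i _.
  by have := h i; rewrite negbK => /eqP ->; rewrite scale0r.
have g_u w : g w = u w + w by rewrite add_lfunE opp_lfunE id_lfunE subrK.
have iter_linear1 n x y : iter n u (x + y) = iter n u x + iter n u y.
  by rewrite -[x]scale1r (iter_linear n) !scale1r.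
pose c : 'Hom(W, k^o) := linfun (coord e i : W -> k^o).
pose U' j := linfun (U j).
exists (c \o U' j)%VF, (c \o U' j.+1)%VF, w0; split.
- by rewrite comp_lfunE !lfunE.
- apply/lfunP => w; rewrite add_lfunE !comp_lfunE -linearD; congr (c _).
  by rewrite !lfunE /= g_u iter_linear1 -iterSr addrC.
apply/lfunP => w; rewrite !comp_lfunE; congr (c _); rewrite !lfunE.
by rewrite -[LHS]/(iter j.+1 u (g w)) g_u iter_linear1 -iterSr Qj add0r.
Qed.

Definition tensor_eval n (nu : 'I_n -> 'Hom(W, k^o)) (x : tpow W n) : k :=
  \sum_t x t * \prod_i nu i e`_(t i).

Lemma tensor_eval_linear n (nu : 'I_n -> 'Hom(W, k^o)) : linear (tensor_eval nu : tpow W n -> k^o).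
Proof.
move=> c x y; rewrite /tensor_eval scaler_sumr -big_split; apply: eq_bigr => t _.
by rewrite !ffunE mulrDl; congr (_ + _); exact/esym/mulrA.
Qed.

HB.instance Definition _ n (nu : 'I_n -> 'Hom(W, k^o)) :=
  GRing.isLinear.Build k (tpow W n) k^o _ (tensor_eval nu) (tensor_eval_linear nu).

Lemma tensor_eval_tens n (nu : 'I_n -> 'Hom(W, k^o)) (w : 'I_n -> W) :
  tensor_eval nu (tens w) = \prod_i nu i (w i).
Proof.
transitivity (\sum_(t : {ffun 'I_n -> 'I_(\dim {:W})}) \prod_i (coord e (t i) (w i) * nu i e`_(t i))).
  by apply: eq_bigr => t _; rewrite ffunE big_split.
rewrite -(bigA_distr_bigA (fun i j => coord e j (w i) * nu i e`_j)) /=.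
apply: eq_bigr => i _; rewrite {2}(coord_vbasis (memvf (w i))) linear_sum /=.
by apply: eq_bigr => j _; rewrite linearZ.
Qed.

Lemma tensor_eval_tmap n (nu : 'I_n -> 'Hom(W, k^o)) g (x : tpow W n) :
  tensor_eval nu (tmap g x) = tensor_eval (fun i => nu i \o g)%VF x.
Proof.
rewrite [x]tens_decomp !linear_sum /=; apply: eq_bigr => t _.
rewrite !linearZ /= tmap_tens !tensor_eval_tens;
by under [in RHS]eq_bigr => i _ do rewrite comp_lfunE.
Qed.

Lemma tensor_eval_tact n (nu : 'I_n -> 'Hom(W, k^o)) s (x : tpow W n) :
  tensor_eval nu (tact s x) = tensor_eval (fun i => nu (s i)) x.
Proof.
pose h (t : {ffun 'I_n -> 'I_(\dim {:W})}) := [ffun i => t ((s^-1)%g i)].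
have h_inj : injective h.
  move=> t u /ffunP E; apply/ffunP => i.
  by have := E (s i); rewrite !ffunE permK.
rewrite /tensor_eval (reindex_inj h_inj) /=; apply: eq_bigr => t _; rewrite ffunE; congr (x _ * _).
  by apply/ffunP => i; rewrite !ffunE permK.
by rewrite (reindex_inj (@perm_inj _ s)); apply: eq_bigr => i _; rewrite ffunE permK.
Qed.

Lemma tensor_eval_tmul m n (nu : 'I_(m + n) -> 'Hom(W, k^o)) (x : tpow W m) (y : tpow W n) :
  tensor_eval nu (tmul x y) =
    tensor_eval (fun i => nu (lshift n i)) x * tensor_eval (fun i => nu (rshift m i)) y.
Proof.
pose I := 'I_(\dim {:W}).
pose h (t : {ffun 'I_m -> I} * {ffun 'I_n -> I}) : {ffun 'I_(m + n) -> I} :=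
  [ffun i => match split i with inl a => t.1 a | inr b => t.2 b end].
have hl t : [ffun i => h t (lshift n i)] = t.1.
  by apply/ffunP => i; rewrite !ffunE (unsplitK (inl i)).
have hr t : [ffun i => h t (rshift m i)] = t.2.
  by apply/ffunP => i; rewrite !ffunE (unsplitK (inr i)).
rewrite /tensor_eval (reindex h) /=; last first.
  exists (fun t => ([ffun i => t (lshift n i)], [ffun i => t (rshift m i)])) => t _.
    by rewrite hl hr; case: t.
  by apply/ffunP => i; rewrite ffunE; case: split_ordP => j ->; rewrite ffunE.
rewrite mulr_suml; under [RHS]eq_bigr => t _ do rewrite mulr_sumr.
rewrite pair_bigA; apply: eq_bigr => t _; rewrite ffunE hl hr big_split_ord mulrACA.
congr (_ * _ * (_ * _)); apply: eq_bigr => i _.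
  by have /ffunP/(_ i) := hl t; rewrite ffunE => ->.
by have /ffunP/(_ i) := hr t; rewrite ffunE => ->.
Qed.

Lemma tensor_eval_invariant_eq0 n (x : inv_obj G n) (g : 'End(W)) (l m : 'Hom(W, k^o)) :
  g \in G -> (l \o g)%VF = l + m -> (m \o g)%VF = m -> (0 < n)%N ->
  tensor_eval (fun=> m) (vsval x) = 0.
Proof.
case: n x => // n x gG lg mg _.
pose nu0 (l' : 'Hom(W, k^o)) (i : 'I_n.+1) := if i == ord0 then l' else m.
have evD : tensor_eval (nu0 (l + m)) (vsval x) =
  tensor_eval (nu0 l) (vsval x) + tensor_eval (nu0 m) (vsval x).
  rewrite /tensor_eval -big_split; apply: eq_bigr => t _; rewrite /= -mulrDr !big_ord_recl.
  by rewrite /nu0 /= add_lfunE mulrDl.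
have em : tensor_eval (nu0 m) (vsval x) = tensor_eval (fun=> m) (vsval x).
  by congr (tensor_eval _ _); apply/funext => i; rewrite /nu0 if_same.
move: evD; rewrite -{2}(tinvP _ _ (subvsP x) g gG) tensor_eval_tmap.
rewrite (_ : (fun i => _) = nu0 (l + m)) ?em.
  by rewrite -[LHS]addr0 => /addrI/esym.
by apply/funext => i; rewrite /nu0; case: eqP.
Qed.

Definition order_away (m : 'Hom(W, k^o)) n (nu : 'I_n -> 'Hom(W, k^o)) : nat :=
  (\sum_i (nu i != m))%N.

Lemma fg_vanishing D (g : 'End(W)) (l m : 'Hom(W, k^o)) :
  g \in G -> (l \o g)%VF = l + m -> (m \o g)%VF = m ->
  tca_generated_in_degree_le (invariant_tca G) D ->
  forall n (x : inv_obj G n) nu, tensor_eval nu (vsval x) != 0 -> (n <= D * order_away m nu)%N.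
Proof.
move=> gG lg mg [S [SD Sgen]] n x.
pose P : gsubset (invariant_tca G) := fun n (x : inv_obj G n) =>
  forall nu, tensor_eval nu (vsval x) != 0 -> (n <= D * order_away m nu)%N.
apply: (Sgen P) => [|[d y] /SD /= dD nu yN0]; last first.
  have [d0|d0] := posnP d; first by apply: leq_trans (leq0n _); rewrite leqn0 d0.
  have [nu0|nuN0] := posnP (order_away m nu); last first.
    by apply: leq_trans dD _; rewrite leq_pmulr.
  case/eqP: yN0; rewrite -[RHS](tensor_eval_invariant_eq0 y gG lg mg d0).
  congr (tensor_eval _ _); apply/funext => i; apply/eqP.
  by move/eqP: nu0; rewrite sum_nat_eq0 => /forallP/(_ i)/=; rewrite eqb0 negbK.
split=> //; first split.
- by move=> d nu; rewrite /= linear0 eqxx.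
- move=> d c y z Py Pz nu; rewrite linearP /=.
  have [y0|/Py//] := eqVneq (tensor_eval nu (vsval y)) 0.
  by rewrite y0 scaler0 add0r => /Pz.
- move=> d s y Py nu; rewrite /= tensor_eval_tact => /Py; rewrite /order_away.
  by rewrite [in X in _ -> X](reindex_inj (@perm_inj _ s)).
move=> d d' y z Py Pz nu; rewrite /= tensor_eval_tmul mulf_eq0 negb_or => /andP[/Py hy /Pz hz].
by rewrite /order_away big_split_ord mulnDr leq_add.
Qed.

Lemma tensor_eval_orbit_sum (s : seq ('Hom(W, k^o) * W)) :
  tensor_eval (fun i => (tnth (in_tuple s) i).1) (orbit_sum G (tens (fun i => (tnth (in_tuple s) i).2))) =
  \sum_(h <- G) \prod_(z <- s) z.1 (h z.2).
Proof.
rewrite /orbit_sum linear_sum; apply: eq_bigr => h _ /=.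
by rewrite tmap_tens tensor_eval_tens [RHS]big_tnth.
Qed.

Theorem modular_not_fg p : p \in [pchar k] -> (p %| #|` G|)%N ->
  ~ tca_finitely_generated (invariant_tca G).
Proof.
move=> p_char pG [S [Sfin Sgen]].
have [D SD] : exists D, forall h, S h -> (tag h <= D)%N.
  have /finite_seqP[s sE] := finite_image (fun h : helt (invariant_tca G) => tag h) Sfin.
  exists (\max_(i <- s) i) => h Sh.
  have : [set` s]%classic (tag h) by rewrite -sE; exists h.
  by move=> /= hs; rewrite (big_rem _ hs) leq_maxl.
have [g [gG g1 gp]] := finite_subgroup_GL_Cauchy (pcharf_prime p_char) pG.
have [l [m [w [mw lg mg]]]] := dual_jordan_pair p_char g1 gp.
have Dgen : tca_generated_in_degree_le (invariant_tca G) D by exists S.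
have bound := fg_vanishing gG lg mg Dgen.
have [N ltN] : exists N, (D * #|` G| < N)%N by exists (D * #|` G|).+1.
have [G1 _ _] := Gsub.
have sum0 (s : seq ('Hom(W, k^o) * W)) : (size s <= #|` G|)%N ->
    \sum_(h <- G) (\prod_(z <- s) z.1 (h z.2)) * m (h w) ^+ N = 0 :> k.
  move=> sG; pose s' := s ++ nseq N (m, w).
  transitivity (\sum_(h <- G) \prod_(z <- s') z.1 (h z.2) : k).
    apply: eq_bigr => h _; rewrite big_cat; congr (_ * _).
    by rewrite big_nseq iter_mulr_1.
  rewrite -tensor_eval_orbit_sum; apply/eqP; apply: contraT.
  rewrite -[orbit_sum _ _]/(vsval (Subvs (orbit_sum_inv Gsub _))) => /bound.
  rewrite /order_away -(big_tnth _ _ _ xpredT (fun z => nat_of_bool (z.1 != m))).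
  have -> : (\sum_(z <- s') (z.1 != m) = \sum_(z <- s) (z.1 != m))%N.
    rewrite big_cat /= -[RHS]addn0; congr addn; rewrite big1_seq // => z.
    by rewrite mem_nseq => /andP[_ /andP[_ /eqP ->]]; rewrite eqxx.
  rewrite size_cat size_nseq => h.
  have h' : (\sum_(z <- s) (z.1 != m) <= size s)%N.
    by rewrite -sum1_size; apply: leq_sum => z _; case: (_ == _).
  by move: h h' sG ltN; nia.
have sum0' (s2 : seq ('Hom(W, k^o) * W * k)) (s1 : seq ('Hom(W, k^o) * W)) :
    (size s1 + size s2 <= #|` G|)%N ->
    \sum_(h <- G) (\prod_(z <- s1) z.1 (h z.2)) *
      (\prod_(z <- s2) (z.1.1 (h z.1.2) - z.2)) * m (h w) ^+ N = 0 :> k.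
  elim: s2 s1 => [|[z c] s2 IH] s1 /= le_s.
    rewrite addn0 in le_s; rewrite -[RHS](sum0 s1 le_s).
    by apply: eq_bigr => h _; rewrite big_nil mulr1.
  have := IH (z :: s1); have := IH s1.
  rewrite /= addSn -addnS le_s (leq_trans _ le_s) ?leq_add2l // => /(_ isT) e1 /(_ isT) e2.
  rewrite -[RHS]subr0 -[X in _ = _ - X](mulr0 c) -[in X in _ - X]e1 -[X in X - _]e2 mulr_sumr -sumrB.
  apply: eq_bigr => h _; rewrite !big_cons /=; ring.
have sep (h : 'End(W)) : exists z : 'Hom(W, k^o) * W * k,
    h != \1%VF -> z.2 = z.1.1 (h z.1.2) /\ z.1.1 z.1.2 != z.2.
  have [h1|h1] := eqVneq h \1%VF; first by exists (0, 0, 0).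
  have [v hv] : exists v, h v != v.
    apply: contrapT => hN; case/eqP: h1; apply/lfunP => v; rewrite id_lfunE.
    by apply: contrapT => /eqP hv; apply: hN; exists v.
  have [i ci] : exists i, coord e i v != coord e i (h v).
    apply/existsP; apply: contraNT hv; rewrite negb_exists => /forallP hv.
    rewrite [h v](coord_vbasis (memvf _)) [eqbRHS](coord_vbasis (memvf v)); apply/eqP.
    by apply: eq_bigr => i _; have := hv i; rewrite negbK => /eqP ->.
  pose c : 'Hom(W, k^o) := linfun (coord e i : W -> k^o).
  by exists (c, v, c (h v)); rewrite /= !lfunE.
have {sep} /choice[f fP] := sep.
pose s2 := [seq f h | h <- G & h != \1%VF].
have s2G : (size ([::] : seq ('Hom(W, k^o) * W)) + size s2 <= #|` G|)%N.
  by rewrite size_map size_filter count_size.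
have /eqP := sum0' _ _ s2G; rewrite (bigD1_seq \1%VF) ?fset_uniq //= [X in _ + X]big1_seq ?addr0 => [|h]; last first.
  move=> /andP[h1 hG]; have h_s2 : f h \in s2 by rewrite map_f // mem_filter h1.
  by rewrite (big_rem _ h_s2) /= (fP h h1).1 subrr mul0r mulr0 mul0r.
rewrite big_nil mul1r mulf_eq0 expf_eq0 id_lfunE (negbTE mw) andbF orbF.
apply/negP; rewrite prodf_seq_neq0; apply/allP => _ /mapP[h + ->].
by rewrite mem_filter => /andP[/fP[_ h2] _]; rewrite id_lfunE subr_eq0.
Qed.
End Modular.

Lemma card_neq0_in_field (k : fieldType) (p n : nat) :
  has_characteristic k p -> (0 < n)%N -> ~~ (p %| n) \/ p = 0 ->
  (n%:R != 0 :> k)%R.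
Proof.
case=> [[-> k0] n0 _|kp n0 [pn|p0]].
- by rewrite pcharf0P in k0; rewrite k0 -lt0n.
- by rewrite -(dvdn_pcharf kp).
by move: kp; rewrite p0 inE.
Qed.

Theorem theorem1p1 (k : fieldType) (p : nat) (W : vectType k) (G : {fset 'End(W)})
    (k_infinite : infinite_set (@setT k))
    (k_char : has_characteristic k p)
    (G_subgroup : finite_subgroup_GL G) :
  (~~ (p %| #|` G|) \/ p = 0 ->
     tca_noetherian (invariant_tca G) /\
     tca_generated_in_degree_le (invariant_tca G) #|` G|) /\
  (0 < p -> p %| #|` G| ->
     ~ tca_finitely_generated (invariant_tca G)).
Proof.
have G_gt0 : 0 < #|` G|.
  by have [G1 _ _] := G_subgroup; rewrite cardfs_gt0; apply/fset0Pn; exists \1%VF.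
split=> [pG|p_gt0 pG].
  have Gk := card_neq0_in_field k_char G_gt0 pG.
  by split; [apply: invariant_tca_noetherian | apply: generated_in_degree_le].
case: k_char => [[p0 _]|kp]; first by rewrite p0 in p_gt0.
exact: modular_not_fg kp pG.
Qed.
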